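(* Let $\alpha$ be an irrational number. Assume that there exist $c>0$ and $\gamma>5$ such that $$\left|\alpha-\frac pq\right|\le\frac{c}{|q|^\gamma}\quad\text{for infinitely many pairs } p,q\in\mathbb Z,\ q\neq0.$$ Let $r$ be the largest positive integer with $r<\frac\gamma2-\frac32$. Then there exists a non-constant function $\varphi:\mathbb S^1\to\mathbb R$ of class $C^r$ with $\int_{\mathbb S^1}\varphi(x)\,dx=0$ such that the central limit theorem fails for the additive functional of $(Y^\alpha_n)_{n\ge1}$ given by $\varphi$; that is, there is no $\sigma>0$ for which $\frac{\varphi(Y_1^\alpha)+\cdots+\varphi(Y_n^\alpha)}{\sqrt n}$ converges in distribution, as $n\to\infty$, to $\mathcal N(0,\sigma)$.
   Context: $\mathbb S^1=\mathbb R/\mathbb Z$ is the circle with normalized Lebesgue measure $\mathrm{Leb}$. For $\alpha\in\mathbb R$, $(Y_n^\alpha)_{n\ge 1}$ denotes the Markov process on $\mathbb S^1$ (defined on some probability space $(\Omega,\mathcal F,\mathbb P)$) with transition kernel $p(x,\cdot)=\frac12\delta_{x+\alpha}+\frac12\delta_{x-\alpha}$ and initial distribution $Y_1^\alpha\sim\mathrm{Leb}$. $\mathcal N(0,\sigma)$ denotes the centered normal distribution with parameter $\sigma>0$ (variance $\sigma^2$). Given $\varphi:\mathbb S^1\to\mathbb R$ with $\int\varphi(x)\,dx=0$, the central limit theorem is said to hold if there is some $\sigma>0$ such that $\frac{\varphi(Y_1^\alpha)+\cdots+\varphi(Y_n^\alpha)}{\sqrt n}\Rightarrow\mathcal N(0,\sigma)$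 as $n\to\infty$. *)

(* Defs.v *)
From HB Require Import structures.
From mathcomp Require Import all_boot all_order all_algebra.
From mathcomp Require Import ring_quotient.
From mathcomp Require Import all_classical all_reals all_analysis.
From mathcomp Require Import measurable_realfun.

Set Implicit Arguments.
Unset Strict Implicit.
Unset Printing Implicit Defensive.

Import Order.TTheory GRing.Theory Num.Theory.
Import numFieldNormedType.Exports.

Local Open Scope classical_set_scope.
Local Open Scope ring_scope.

(* The circle R/Z, as the quotient of the additive group R by the subgroup of
   integers, with the quotient topology and its Borel sigma-algebra. *)
Definition circle (R : realType) : Type :=
  Quotient.quot (GRing.ZmodClosed.clone R (@Num.int_num_subdef R) _).

Section circle_structures.
Context {R : realType}.

HB.instance Definition _ := GRing.Zmodule.on (circle R).

Definition to_circle (x : R) : circle R := \pi_(circle R)%qT x.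

Definition circle_open (U : set (circle R)) : Prop := open (to_circle @^-1` U).

Let circle_openT : circle_open [set: circle R].
Proof. by rewrite /circle_open preimage_setT; exact: openT. Qed.

Let circle_openI : setI_closed circle_open.
Proof. by move=> A B oA oB; rewrite /circle_open preimage_setI; exact: openI. Qed.

Let circle_open_bigcup (I : Type) (f : I -> set (circle R)) :
  (forall i, circle_open (f i)) -> circle_open (\bigcup_i f i).
Proof.
move=> fo; rewrite /circle_open preimage_bigcup.
by apply: bigcup_open => i _; exact: fo.
Qed.

HB.instance Definition _ := isPointed.Build (circle R) 0.
HB.instance Definition _ := @isOpenTopological.Build (circle R) circle_open
  circle_openT circle_openI circle_open_bigcup.

Definition circle_display : measure_display := (@open (circle R)).-sigma.

HB.instance Definition _ := @isMeasurable.Build circle_display (circle R)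
  <<s @open (circle R) >> (@sigma_algebra0 _ setT _) (@sigma_algebraC _ _)
  (@sigma_algebra_bigcup _ setT _).

End circle_structures.

Section circle_measure.
Context {R : realType}.

Lemma to_circleD : {morph @to_circle R : x y / x + y}.
Proof. exact: Quotient.pi_add. Qed.

Lemma to_circleK (z : circle R) : to_circle (repr z) = z.
Proof. exact: reprK. Qed.

Lemma continuous_to_circle : continuous (@to_circle R).
Proof. exact/continuousP. Qed.

Lemma measurable_to_circle :
  measurable_fun [set: measurableTypeR R] (@to_circle R).
Proof.
apply: (measurability (@open (circle R))) => // _ [A oA <-].
by rewrite setTI; exact: open_measurable.
Qed.

(* [to_circle] on the carrier [measurableTypeR R] of Lebesgue measure, where HB
   can attach the measurable-function structure. *)
Definition borel_to_circle : measurableTypeR R -> circle R := to_circle.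

HB.instance Definition _ :=
  @isMeasurableFun.Build _ _ (measurableTypeR R) (circle R)
    borel_to_circle measurable_to_circle.

Lemma measurable_circle_addr (a : circle R) :
  measurable_fun [set: circle R] (fun x => x + a).
Proof.
apply: (measurability (@open (circle R))) => // _ [A oA <-].
rewrite setTI; apply: sub_sigma_algebra.
rewrite /open /= /circle_open (_ : _ @^-1` _ =
  (fun x : R => x + repr a) @^-1` (to_circle @^-1` A)); last first.
  by apply/funext => x /=; rewrite to_circleD to_circleK.
apply: open_comp; last exact: oA.
by move=> x _; apply: cvgD; [exact: cvg_id|exact: cvg_cst].
Qed.

Definition circle_lebesgue : probability (circle R) R :=
  distribution (uniform_prob (@ltr01 R)) borel_to_circle.

Definition circle_walk (alpha : R) (x : circle R) :
    {measure set (circle R) -> \bar R} :=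
  measure_add
    (mscale (2^-1)%:nng (\d_(x + to_circle alpha)))
    (mscale (2^-1)%:nng (\d_(x - to_circle alpha))).

Section circle_walk_kernel.
Variable alpha : R.

Let measurable_circle_walk U : measurable U ->
  measurable_fun [set: circle R] (circle_walk alpha ^~ U).
Proof.
move=> mU.
have mdirac a : measurable_fun [set: circle R]
    (fun x => \d_(x + a) U : \bar R).
  exact: (measurable_kernel (kdirac (measurable_circle_addr a)) U mU).
rewrite (_ : circle_walk alpha ^~ U = (fun x =>
    (2^-1)%:E * \d_(x + to_circle alpha)%R U
    + (2^-1)%:E * \d_(x - to_circle alpha)%R U)%E); last first.
  by apply/funext => x; exact: measure_addE.
by apply: emeasurable_funD; apply: measurable_funeM; exact: mdirac.
Qed.

HB.instance Definition _ := isKernel.Build _ _ _ _ R (circle_walk alpha)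
  measurable_circle_walk.

Let circle_walk_prob x : circle_walk alpha x [set: circle R] = 1%E.
Proof.
rewrite [LHS]measure_addE.
have half z : mscale (2^-1)%:nng (\d_z : {measure set (circle R) -> \bar R})
    [set: circle R] = (2^-1)%:E.
  by rewrite /mscale /= [X in (_ * X)%E]diracT mule1.
by rewrite [X in (X + _)%E]half [X in (_ + X)%E]half -EFinD
  [in RHS](splitr 1) div1r.
Qed.

HB.instance Definition _ := Kernel_isProbability.Build _ _ _ _ R
  (circle_walk alpha) circle_walk_prob.

End circle_walk_kernel.

End circle_measure.

(* Y 0 plays the role of the initial variable Y_1.  The second clause reads
   P(Y_{n+1} \in A | Y_0, ..., Y_n) = kappa(Y_n, A) almost surely. *)
Definition markov_process {R : realType} {d} {Omega : measurableType d}
    {d'} {T : measurableType d'} {P : probability Omega R}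
    (kappa : R.-pker T ~> T) (mu : probability T R) (Y : nat -> {RV P >-> T}) :
    Prop :=
  (forall A, measurable A -> distribution P (Y 0%N) A = mu A) /\
  (forall n (B : set Omega) (A : set T),
     <<s \bigcup_(k in [set k | (k <= n)%N]) g_sigma_algebra_preimage (Y k) >> B ->
     measurable A ->
     P (B `&` Y n.+1 @^-1` A) = (\int[P]_(w in B) kappa (Y n w) A)%E).

Definition cvg_in_distribution {R : realType} {d} {Omega : measurableType d}
    (P : probability Omega R) (X : nat -> Omega -> R)
    (mu : probability (measurableTypeR R) R) : Prop :=
  forall f : R -> R, continuous f -> bounded_fun f ->
    ('E_P[f \o X n])%E @[n --> \oo] --> (\int[mu]_x (f x)%:E)%E.

Definition clt_holds {R : realType} {d} {Omega : measurableType d}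
    {T : Type} (P : probability Omega R) (Y : nat -> Omega -> T)
    (phi : T -> R) : Prop :=
  exists2 sigma : R, 0 < sigma &
    cvg_in_distribution P
      (fun n w => (\sum_(k < n) phi (Y k w)) / Num.sqrt n%:R)
      (normal_prob 0 sigma).

Definition circle_Cr {R : realType} (r : nat) (phi : circle R -> R) : Prop :=
  let f := phi \o to_circle in
  (forall k x, (k < r)%N -> derivable (f^`(k))%classic x 1) /\
  continuous (f^`(r))%classic.

(* Main.v *)
(* The cosine e_m(x) = cos (2 pi m x) is an eigenfunction of the kernel, with
   eigenvalue c_m = cos (2 pi m alpha).  Since alpha is irrational, |c_m| < 1,
   and the additive functional of each single e_m has variance O(n).  But when
   alpha is very close to p/m, 1 - c_m is tiny and over a long time n the walk
   hardly changes the value of e_m, so its additive functional is about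
   n e_m(Y_0).  Take phi = sum_k a_k e_(m_k) with a_k = 16^-k / m_k^s and with
   m_k chosen inductively among the denominators of good approximations: at a
   time n = (L m_K^s)^2 with L large in terms of m_0, ..., m_(K-1), the terms
   k < K contribute O(1) to the normalised sum (in mean), the terms k > K are
   dominated by the K-th one, and the latter has size about L / 16^K |e_(m_K)(Y_0)|.
   Hence a fixed positive proportion of the mass of the normalised sums escapes
   to infinity along a subsequence, and no weak limit exists.  With s = r + 2 the
   series of (r + 2)-nd derivatives is dominated by a geometric series, whence
   phi is of class C^r. *)

Require Import Defs.
From mathcomp Require Import all_boot all_order all_algebra.
From mathcomp Require Import all_classical all_reals all_analysis.
From mathcomp Require Import measurable_realfun.
From mathcomp Require Import ring lra.

Import Order.TTheory GRing.Theory Num.Theory.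
Import numFieldNormedType.Exports.

Local Open Scope classical_set_scope.
Local Open Scope ring_scope.

(** * Cosine series *)

Section analysis.
Context {R : realType}.
Implicit Types (x y h : R) (f g : R -> R).

Lemma geometric_dominated_cvg (u : R^nat) (A : R) :
  (forall k, `|u k| <= A * 16^-1 ^+ k) -> cvgn (series u).
Proof.
move=> uA; apply: (@normed_cvg _ R^o).
apply: (@series_le_cvg _ _ (geometric A 16^-1));
  [by move=> k; exact: normr_ge0 | | exact: uA | ].
- by move=> k /=; exact: le_trans (normr_ge0 _) (uA k).
- by apply: is_cvg_geometric_series; rewrite ger0_norm; lra.
Qed.

Lemma geometric_dominated_tail (u : R^nat) (A : R) (K : nat) :
  cvgn (series u) -> (forall k, `|u (K + k)%N| <= A * 16^-1 ^+ k) ->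
  `|limn (series u) - series u K| <= A * (16 / 15).
Proof.
move=> cu uA.
have A0 : 0 <= A by have := le_trans (normr_ge0 _) (uA 0%N); rewrite expr0 mulr1.
(* The right-hand side is the exact partial geometric sum, so that the induction closes; it is
   relaxed to [A * (16 / 15)] before passing to the limit. *)
have bnd n : `|series u (K + n)%N - series u K| <= A * (16 / 15) * (1 - 16^-1 ^+ n).
  elim: n => [|n IH]; first by rewrite addn0 !subrr normr0 mulr0.
  rewrite addnS /series /= big_nat_recr//= -/(series u (K + n)%N).
  rewrite addrAC; apply: (le_trans (ler_normD _ _)).
  apply: (le_trans (lerD IH (uA n))); rewrite exprS; lra.
have cd : cvgn (fun n => `|series u n - series u K|).
  by apply: is_cvg_norm; apply: is_cvgB => //; exact: is_cvg_cst.
have -> : `|limn (series u) - series u K| = limn (fun n => `|series u n - series u K|).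
  apply/esym/cvg_lim => //; apply: cvg_norm; apply: cvgB => //; exact: cvg_cst.
apply: limr_le => //; exists K => // n /= Kn.
rewrite -(subnKC Kn); apply: le_trans (bnd _) _.
by rewrite ler_piMr ?mulr_ge0// gerBl exprn_ge0.
Qed.

Lemma sin_lipschitz x y : `|sin x - sin y| <= `|x - y|.
Proof.
wlog yx : x y / y <= x.
  by move=> H; have [/H//|/ltW/H] := leP y x; rewrite distrC [leRHS]distrC.
have [c _ ->] : exists2 c, c \in `[y, x]%R & sin x - sin y = cos c * (x - y).
  apply: MVT_segment => //.
  by apply: continuous_subspaceT; exact: continuous_sin.
by rewrite normrM ler_piMl// cos_max.
Qed.

(** By the mean value theorem the increment is [- sin c * h] with [c] within [|h|] of [x], and sine
    is 1-Lipschitz. *)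
Lemma cos_taylor1 x h : `|cos (x + h) - cos x + h * sin x| <= h ^+ 2.
Proof.
have E c : `|c - x| <= `|h| -> `|- sin c * h + h * sin x| <= h ^+ 2.
  move=> ch; rewrite mulNr addrC (mulrC _ h) -mulrBr normrM -(real_normK (num_real h)) expr2.
  by rewrite ler_wpM2l// (le_trans (sin_lipschitz _ _))// distrC.
have [h0|h0] := leP 0 h.
  have [c + ->] : exists2 c, c \in `[x, x + h]%R &
      cos (x + h) - cos x = - sin c * (x + h - x).
    apply: (@MVT_segment _ _ (fun x => - sin x)); first by lra.
    by apply: continuous_subspaceT; exact: continuous_cos.
  rewrite in_itv/= => /andP[c1 c2]; rewrite (_ : x + h - x = h); last by ring.
  by apply: E; rewrite !ger0_norm; lra.
have [c + H] : exists2 c, c \in `[x + h, x]%R &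
    cos x - cos (x + h) = - sin c * (x - (x + h)).
  apply: (@MVT_segment _ _ (fun x => - sin x)); first by lra.
  by apply: continuous_subspaceT; exact: continuous_cos.
rewrite in_itv/= => /andP[c1 c2].
have -> : cos (x + h) - cos x = - sin c * h.
  by rewrite -opprB H; ring.
by apply: E; rewrite !ler0_norm; lra.
Qed.

Lemma one_sub_cos_le x : 1 - cos x <= x ^+ 2.
Proof.
have := cos_taylor1 0 x; rewrite sin0 cos0 mulr0 addr0 add0r => H.
by apply: le_trans H; rewrite distrC ler_norm.
Qed.

(** Quadratic remainders can be summed term by term, so this criterion differentiates a series
    without an exchange of limits. *)
Lemma is_derive_quadratic f x (l B : R) :
  (forall h, `|f (x + h) - f x - h * l| <= B * h ^+ 2) -> is_derive x 1 f l.
Proof.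
move=> H.
have B0 : 0 <= B by have := le_trans (normr_ge0 _) (H 1); rewrite expr1n mulr1.
have cl : h^-1 *: ((f \o shift x) (h *: 1) - f x) @[h --> 0^'] --> l.
  apply/cvgrPdist_le => /= e e0.
  (* Dividing by [B + 1] covers the case [B = 0]. *)
  have d0 : 0 < e / (B + 1) by rewrite divr_gt0//; lra.
  near=> h.
  have h0 : h != 0 by near: h; exact: nbhs_dnbhs_neq.
  have hd : `|h| <= e / (B + 1).
    near: h; apply: dnbhs0_le => //.
  rewrite /= /GRing.scale/= mulr1.
  have -> : l - h^-1 * (f (h + x) - f x) = - h^-1 * (f (x + h) - f x - h * l).
    by rewrite (addrC h x); field.
  rewrite normrM normrN normfV ler_pdivrMl ?normr_gt0//.
  apply: (le_trans (H h)); rewrite -(real_normK (num_real h)) expr2 mulrCA ler_wpM2l//.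
  apply: (le_trans (ler_wpM2l B0 hd)); rewrite mulrA ler_pdivrMr; nra.
by apply: DeriveDef; [apply/cvg_ex; exists l | exact/cvg_lim].
Unshelve. all: by end_near. Qed.

(** The phase [t] keeps the family closed under differentiation: a derivative multiplies the
    amplitudes by the frequencies and adds [pi / 2] to [t]. *)
Definition cos_series (a w : nat -> R) (t x : R) : R :=
  limn (series (fun k => a k * cos (w k * x + t))).

Section cos_series.
Variables (a w : nat -> R) (A : R).
Hypothesis w_ge1 : forall k, 1 <= w k.

Let normM_cos k y : `|a k * cos y| <= `|a k|.
Proof. by rewrite normrM ler_piMr// cos_max. Qed.

Lemma cos_series_cvg t x : (forall k, `|a k| <= A * 16^-1 ^+ k) ->
  cvgn (series (fun k => a k * cos (w k * x + t))).
Proof.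
by move=> aA; apply: (@geometric_dominated_cvg _ A) => k; exact: le_trans (aA k).
Qed.

(** The [k]-th term has a Taylor remainder of at most [|a k| * w k ^+ 2 * h ^+ 2]; the hypothesis
    makes these sum to a constant times [h ^+ 2]. *)
Lemma is_derive_cos_series t x :
  (forall k, `|a k| * w k ^+ 2 <= A * 16^-1 ^+ k) ->
  is_derive x 1 (cos_series a w t)
    (cos_series (fun k => a k * w k) w (t + pi / 2) x).
Proof.
move=> aA.
have aA1 k : `|a k * w k| <= A * 16^-1 ^+ k.
  apply: le_trans (aA k); rewrite normrM ler_wpM2l// ger0_norm ?(le_trans ler01)//.
  by rewrite ler_eXnr.
have aA0 k : `|a k| <= A * 16^-1 ^+ k.
  by apply: le_trans (aA1 k); rewrite normrM ler_peMr// ger0_norm// (le_trans ler01).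
apply: (@is_derive_quadratic _ _ _ (A * (16 / 15))) => h.
pose u1 k := a k * cos (w k * (x + h) + t).
pose u2 k := a k * cos (w k * x + t).
pose u3 k := a k * w k * cos (w k * x + (t + pi / 2)).
rewrite /cos_series -/u1 -/u2 -/u3.
have c1 : cvgn (series u1) by exact: cos_series_cvg aA0.
have c2 : cvgn (series u2) by exact: cos_series_cvg aA0.
have c3 : cvgn (series u3).
  apply: (@geometric_dominated_cvg _ A) => k.
  by rewrite /u3 normrM (le_trans _ (aA1 k))// ler_piMr// cos_max.
rewrite -(lim_seriesB c1 c2).
have -> : h * limn (series u3) = limn (series (h *: u3)) by rewrite lim_seriesZ.
rewrite -lim_seriesB//; last 2 first.
  exact: is_cvg_seriesB.
  exact: is_cvg_seriesZ.
set u := u1 - u2 - _.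
have ub k : `|u k| <= (A * h ^+ 2) * 16^-1 ^+ k.
  have -> : u k = a k * (cos (w k * x + t + w k * h) - cos (w k * x + t) +
      w k * h * sin (w k * x + t)).
    rewrite /u /u1 /u2 /u3 !fctE/= /GRing.scale/= addrA cosDpihalf mulrDr.
    by rewrite (addrAC (w k * x)); ring.
  rewrite normrM; apply: (le_trans (ler_wpM2l (normr_ge0 _) (cos_taylor1 _ _))).
  by rewrite exprMn mulrA [leRHS]mulrAC ler_wpM2r// sqr_ge0.
(* The whole remainder series is bounded as its own tail after zero terms. *)
rewrite -[limn _]subr0 mulrAC.
have -> : 0 = series u 0 by rewrite /series/= big_geq.
apply: geometric_dominated_tail => //.
exact: geometric_dominated_cvg ub.
Qed.

End cos_series.

End analysis.

(** * Bounded random variables *)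

Section bounded_random_variables.
Context {d} {T : measurableType d} {R : realType} (P : probability T R).
Implicit Types (X Y Z xi : T -> R) (B : set T).

(** A class stable under sums, products and powers and always integrable, so that expectations are
    real numbers and side conditions are settled by closure. *)
Definition bounded_rv X : Prop :=
  measurable_fun [set: T] X /\ exists M, forall w, `|X w| <= M.

Lemma bounded_rv_integrable X :
  bounded_rv X -> P.-integrable [set: T] (EFin \o X).
Proof.
move=> [mX [M XM]]; apply: measurable_bounded_integrable => //.
  by rewrite (le_lt_trans (probability_le1 _ _)) ?ltry.
exists M; split; first exact: num_real.
by move=> x Mx w _; rewrite /= (le_trans (XM w))// ltW.
Qed.

Lemma bounded_rv_cst c : bounded_rv (fun=> c).
Proof. by split; [exact: measurable_cst | exists `|c|]. Qed.

Lemma bounded_rvD X Y :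
  bounded_rv X -> bounded_rv Y -> bounded_rv (fun w => X w + Y w).
Proof.
move=> [mX [M XM]] [mY [N YN]]; split; first exact: measurable_funD.
by exists (M + N) => w; rewrite (le_trans (ler_normD _ _))// lerD.
Qed.

Lemma bounded_rvM X Y :
  bounded_rv X -> bounded_rv Y -> bounded_rv (fun w => X w * Y w).
Proof.
move=> [mX [M XM]] [mY [N YN]]; split; first exact: measurable_funM.
by exists (M * N) => w; rewrite normrM ler_pM.
Qed.

Lemma bounded_rvZ c X : bounded_rv X -> bounded_rv (fun w => c * X w).
Proof. by apply: bounded_rvM; exact: bounded_rv_cst. Qed.

Lemma bounded_rvB X Y :
  bounded_rv X -> bounded_rv Y -> bounded_rv (fun w => X w - Y w).
Proof.
move=> bX bY; rewrite (_ : (fun _ => _) = fun w => X w + -1 * Y w).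
  exact/bounded_rvD/bounded_rvZ.
by apply/funext => w; rewrite mulN1r.
Qed.

Lemma bounded_rvX X n : bounded_rv X -> bounded_rv (fun w => X w ^+ n).
Proof.
move=> bX; elim: n => [|n IH].
  by under eq_fun do rewrite expr0; exact: bounded_rv_cst.
by under eq_fun do rewrite exprS; exact: bounded_rvM.
Qed.

Lemma bounded_rv_sum n (F : nat -> T -> R) : (forall i, bounded_rv (F i)) ->
  bounded_rv (fun w => \sum_(i < n) F i w).
Proof.
move=> bF; elim: n => [|n IH].
  by under eq_fun do rewrite big_ord0; exact: bounded_rv_cst.
by under eq_fun do rewrite big_ord_recr/=; exact: bounded_rvD.
Qed.

Lemma bounded_rv_indic B : measurable B -> bounded_rv (\1_B : T -> R).
Proof.
move=> mB; split; first exact: measurable_indic.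
by exists 1 => w; rewrite indicE; case: (_ \in _); rewrite ?normr1 ?normr0.
Qed.

Lemma mean_cst c : \int[P]_w c = c.
Proof. by rewrite Rintegral_cst// [X in fine X](@probability_setT _ _ _ P) mulr1. Qed.

Lemma meanD X Y : bounded_rv X -> bounded_rv Y ->
  \int[P]_w (X w + Y w) = \int[P]_w X w + \int[P]_w Y w.
Proof. by move=> ? ?; rewrite RintegralD//; exact: bounded_rv_integrable. Qed.

Lemma meanB X Y : bounded_rv X -> bounded_rv Y ->
  \int[P]_w (X w - Y w) = \int[P]_w X w - \int[P]_w Y w.
Proof. by move=> ? ?; rewrite RintegralB//; exact: bounded_rv_integrable. Qed.

Lemma meanZ c X : bounded_rv X -> \int[P]_w (c * X w) = c * \int[P]_w X w.
Proof. by move=> ?; rewrite RintegralZl//; exact: bounded_rv_integrable. Qed.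

Lemma mean_sum n (F : nat -> T -> R) : (forall i, bounded_rv (F i)) ->
  \int[P]_w (\sum_(i < n) F i w) = \sum_(i < n) \int[P]_w F i w.
Proof.
move=> bF; elim: n => [|n IH].
  by under eq_Rintegral do rewrite big_ord0; rewrite mean_cst big_ord0.
under eq_Rintegral do rewrite big_ord_recr/=.
by rewrite meanD// ?IH ?big_ord_recr//; exact: bounded_rv_sum.
Qed.

Lemma le_mean X Y : bounded_rv X -> bounded_rv Y -> (forall w, X w <= Y w) ->
  \int[P]_w X w <= \int[P]_w Y w.
Proof. by move=> ? ? XY; rewrite le_Rintegral//; exact: bounded_rv_integrable. Qed.

Lemma mean_norm_le X M : bounded_rv X -> (forall w, `|X w| <= M) ->
  `|\int[P]_w X w| <= M.
Proof.
have bc := bounded_rv_cst.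
move=> bX XM; rewrite ler_norml; apply/andP; split.
  by rewrite -[leLHS]mean_cst le_mean// => w; have := XM w; rewrite ler_norml => /andP[].
by rewrite -[leRHS]mean_cst le_mean// => w; have := XM w; rewrite ler_norml => /andP[].
Qed.

Lemma mean_indic B : measurable B -> \int[P]_w \1_B w = fine (P B).
Proof. by move=> mB; rewrite /Rintegral integral_indic// setIT. Qed.

(** On [[0, 1]] this is [z] rounded down to a multiple of [1 / (N + 1)], written as an average of
    indicators of level sets. *)
Definition layer (N : nat) (z : R) : R :=
  N.+1%:R^-1 * \sum_(l < N.+1) ((l.+1%:R / N.+1%:R <= z)%R : nat)%:R.

Lemma layer_approx N z : 0 <= z <= 1 -> `|z - layer N z| <= N.+1%:R^-1.
Proof.
move=> /andP[z0 z1].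
have N0 : (0 : R) < N.+1%:R by rewrite ltr0n.
(* The sum counts the positive integers up to [x], hence is the floor of [x]. *)
have H n x : 0 <= x <= n%:R ->
    (\sum_(l < n) ((l.+1%:R <= x)%R : nat)%:R : R) <= x <=
    \sum_(l < n) ((l.+1%:R <= x)%R : nat)%:R + 1.
  elim: n x => [|n IH] x /andP[x0 xn]; first by rewrite big_ord0 x0; lra.
  rewrite big_ord_recr/=; have [xn'|nx] := leP x n%:R.
    have := IH x; rewrite x0 xn' => /(_ isT).
    suff -> : (n.+1%:R <= x) = false by rewrite addr0.
    by apply/negbTE; rewrite -ltNge (le_lt_trans xn')// ltr_nat.
  have -> : (\sum_(l < n) ((l.+1%:R <= x)%R : nat)%:R : R) = n%:R.
    rewrite (eq_bigr (fun=> 1)) => [|i _]; first by rewrite sumr_const card_ord.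
    by rewrite (le_trans _ (ltW nx))// ler_nat.
  rewrite -natr1 in xn *; set m : R := n%:R in nx xn *.
  case: (leP (m + 1) x) => h /=; rewrite ?mulr1n ?mulr0n; apply/andP; split; lra.
have := H N.+1 (z * N.+1%:R); rewrite mulr_ge0//= ler_piMl// => /(_ isT).
under eq_bigr do rewrite -ler_pdivrMr//.
move=> /andP[h1 h2]; rewrite /layer.
rewrite [X in `|X - _|](_ : z = N.+1%:R^-1 * (z * N.+1%:R)); last first.
  by rewrite mulrC mulfK// gt_eqF.
rewrite -mulrBr normrM ger0_norm ?invr_ge0// ler_piMr ?invr_ge0//.
set s := \sum_(_ < _) _ in h1 h2 *.
rewrite ger0_norm; lra.
Qed.

Lemma indic_level Z t w :
  \1_(Z @^-1` `[t, +oo[) w = ((t <= Z w)%R : nat)%:R :> R.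
Proof.
rewrite indicE; congr ((nat_of_bool _)%:R).
by apply/idP/idP; rewrite inE/= in_itv/= andbT.
Qed.

Lemma bounded_rv_layer N Z : bounded_rv Z -> bounded_rv (layer N \o Z).
Proof.
move=> [mZ _]; apply: bounded_rvZ.
apply: (@bounded_rv_sum _ (fun l w => ((l.+1%:R / N.+1%:R <= Z w)%R : nat)%:R)) => i.
rewrite (_ : (fun _ => _) = \1_(Z @^-1` `[i.+1%:R / N.+1%:R, +oo[)).
  apply: bounded_rv_indic; rewrite -[X in measurable X]setTI; exact: mZ.
by apply/funext => w; rewrite indic_level.
Qed.

(* By uniform approximation with averages of indicators of level sets. *)
Lemma mean_layer_cake n (Z xi : 'I_n -> T -> R) :
  (forall i, bounded_rv (Z i)) -> (forall i w, 0 <= Z i w <= 1) ->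
  (forall i, bounded_rv (xi i)) ->
  (forall t, \sum_i \int[P]_w (\1_(Z i @^-1` `[t, +oo[) w * xi i w) = 0) ->
  \sum_i \int[P]_w (Z i w * xi i w) = 0.
Proof.
move=> bZ Z01 bxi Ht.
have [C xiC] : exists C, forall i w, `|xi i w| <= C.
  have /choice[M HM] i : exists M, forall w, `|xi i w| <= M by have [] := bxi i.
  exists (\sum_i M i) => i w; rewrite (le_trans (HM i w))// (bigD1 i)//= lerDl.
  by apply: sumr_ge0 => j _; exact: le_trans (HM j w).
have lay0 N : \sum_i \int[P]_w (layer N (Z i w) * xi i w) = 0.
  have bL l i : bounded_rv (fun w => \1_(Z i @^-1` `[l.+1%:R / N.+1%:R, +oo[) w * xi i w).
    apply: bounded_rvM => //; apply: bounded_rv_indic.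
    by rewrite -[X in measurable X]setTI; have [mZ _] := bZ i; exact: mZ.
  have E i : \int[P]_w (layer N (Z i w) * xi i w) = N.+1%:R^-1 *
      \sum_(l < N.+1) \int[P]_w (\1_(Z i @^-1` `[l.+1%:R / N.+1%:R, +oo[) w * xi i w).
    rewrite -(mean_sum _ (fun l w => \1_(Z i @^-1` `[l.+1%:R / N.+1%:R, +oo[) w * xi i w))//.
    rewrite -meanZ; last first.
      exact: (bounded_rv_sum _ (fun l w => \1_(Z i @^-1` `[l.+1%:R / N.+1%:R, +oo[) w * xi i w)).
    apply: eq_Rintegral => w _; rewrite /layer -mulrA mulr_suml; congr (_ * _).
    apply: eq_bigr => l _; congr (_ * _).
    by rewrite indic_level.
  under eq_bigr do rewrite E.
  rewrite -mulr_sumr exchange_big/=.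
  by rewrite big1 ?mulr0// => l _; exact: Ht.
set S := \sum_i _.
have bnd N : `|S| <= n%:R * (C * N.+1%:R^-1).
  have -> : S = \sum_i \int[P]_w ((Z i w - layer N (Z i w)) * xi i w).
    rewrite -[LHS]subr0 -[X in _ - X](lay0 N) /S -sumrB; apply: eq_bigr => i _.
    rewrite -meanB; [|exact: bounded_rvM|].
      by apply: eq_Rintegral => w _; rewrite mulrBl.
    by apply: bounded_rvM => //; exact: bounded_rv_layer.
  apply: (le_trans (ler_norm_sum _ _ _)).
  have -> : n%:R * (C * N.+1%:R^-1) = \sum_(i < n) (C * N.+1%:R^-1).
    by rewrite sumr_const card_ord mulr_natl.
  apply: ler_sum => i _; apply: mean_norm_le.
    apply: bounded_rvM => //; apply: bounded_rvB => //; exact: bounded_rv_layer.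
  by move=> w; rewrite normrM mulrC ler_pM//; exact: layer_approx.
have C0 : 0 <= n%:R * C.
  by have := le_trans (normr_ge0 _) (bnd 0%N); rewrite invr1 mulr1.
apply/eqP; rewrite -normr_eq0 eq_le normr_ge0 andbT; apply/ler_addgt0Pl => e e0.
rewrite addr0.
have [N HN] : exists N : nat, n%:R * C / e <= N.+1%:R.
  exists (Num.truncn (n%:R * C / e)); apply/ltW/truncnS_gt.
apply: (le_trans (bnd N)); by rewrite mulrA ler_pdivrMr// (mulrC e) -ler_pdivrMr.
Qed.

End bounded_random_variables.

(** * Functions on the circle *)

Section circle_functions.
Context {R : realType}.
Implicit Types (f F : R -> R) (z : circle R) (x y M : R).

(** For 1-periodic [f] this is the function induced on the quotient; in general it depends on the
    chosen representatives. *)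
Definition circle_lift f : circle R -> R := fun z => f (repr z).

Lemma periodic_int f (p : int) x :
  (forall y, f (y + 1) = f y) -> f (x + p%:~R) = f x.
Proof.
move=> f1; have f1n n y : f (y + n%:R) = f y.
  by elim: n => [|n IH]; rewrite ?addr0// -natr1 addrA f1.
case: p => n; first exact: f1n.
by rewrite NegzE mulrNz -[in RHS](subrK n.+1%:R x) f1n.
Qed.

(** The chosen representative of the class of [x] differs from [x] by an integer. *)
Lemma circle_liftE f x : (forall y, f (y + 1) = f y) ->
  circle_lift f (to_circle x) = f x.
Proof.
move=> f1; rewrite /circle_lift.
have : repr (to_circle x) - x \in (@Num.int_num_subdef R).
  rewrite (@Quotient.idealrBE R (GRing.ZmodClosed.clone R (@Num.int_num_subdef R) _)).
  by apply/eqP; exact: to_circleK.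
move=> /intrP[p xp].
by rewrite -(subrK x (repr _)) xp addrC periodic_int.
Qed.

Lemma continuous_circle_lift f : (forall y, f (y + 1) = f y) ->
  continuous f -> continuous (circle_lift f).
Proof.
move=> f1 cf; apply/continuousP => A oA.
rewrite /open /= /circle_open -comp_preimage.
rewrite (_ : _ \o _ = f); first by move/continuousP : cf; exact.
by apply/funext => x /=; exact: circle_liftE.
Qed.

Lemma measurable_circle_lift f : (forall y, f (y + 1) = f y) ->
  continuous f -> measurable_fun [set: circle R] (circle_lift f).
Proof.
move=> f1 cf; apply: (measurability _ (RGenOpens.measurableE R)).
move=> _ [_ [a [b ->] <-]]; rewrite setTI; apply: sub_sigma_algebra.
have /continuousP := continuous_circle_lift f f1 cf; apply.
exact: interval_open.
Qed.

Lemma bounded_circle_lift f M : (forall y, f (y + 1) = f y) -> continuous f ->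
  (forall x, `|f x| <= M) -> bounded_rv (circle_lift f).
Proof.
by move=> f1 cf fM; split; [exact: measurable_circle_lift | exists M => z; exact: fM].
Qed.

(** Lebesgue measure on the circle is the image of the uniform law on [[0, 1]], where the
    fundamental theorem of calculus applies. *)
Lemma mean_circle_lift f F M : (forall y, f (y + 1) = f y) -> continuous f ->
  (forall x, `|f x| <= M) -> (forall x, is_derive x 1 F (f x)) ->
  \int[circle_lebesgue]_z circle_lift f z = F 1 - F 0.
Proof.
move=> f1 cf fM dF.
(* Adding [M] makes the integrand nonnegative, as the change of variables and the integral against
   the uniform law require. *)
pose g (x : R) : R := f x + M; pose G (x : R) : R := F x + M * x.
have dG x : is_derive x 1 G (g x).
  have dM : is_derive x 1 ( *%R M : R -> R) M.
    by apply: (@is_derive_quadratic _ _ _ _ 0) => h; rewrite mul0r normr_le0; apply/eqP; ring.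
  exact: (@is_deriveD _ _ _ F ( *%R M : R -> R)).
have cG : continuous G.
  move=> x; apply/differentiable_continuous/derivable1_diffP.
  exact: (@ex_derive _ _ _ _ _ _ _ (dG x)).
have cg : continuous g by move=> x; apply: cvgD; [exact: cf|exact: cvg_cst].
have g1 y : g (y + 1) = g y by rewrite /g f1.
have g0 x : 0 <= g x.
  by have := fM x; rewrite /g ler_norml => /andP[? _]; lra.
have bf := bounded_circle_lift f M f1 cf fM.
suff E : \int[circle_lebesgue]_z circle_lift g z = G 1 - G 0.
  have -> : \int[circle_lebesgue]_z circle_lift f z =
      \int[circle_lebesgue]_z (circle_lift g z - M).
    by apply: eq_Rintegral => z _; rewrite /circle_lift /g addrK.
  rewrite meanB; [|exact: bounded_rvD bf (bounded_rv_cst M)|exact: bounded_rv_cst].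
  by rewrite E mean_cst /G; ring.
rewrite /Rintegral ge0_integral_distribution; last 2 first.
- by apply/measurable_EFinP; exact: measurable_circle_lift.
- by move=> z; rewrite lee_fin; exact: g0.
transitivity (fine (\int[uniform_prob (@ltr01 R)]_x (g x)%:E)%E).
  by congr fine; apply: eq_integral => x _ /=; rewrite /borel_to_circle circle_liftE.
rewrite integral_uniform; last 2 first.
- by apply/measurable_EFinP; exact: continuous_measurable_fun.
- by move=> x; rewrite lee_fin.
rewrite subr0 invr1 mul1e (continuous_FTC2 (F := G))//=.
- exact: continuous_subspaceT.
- split.
  + by move=> x _; exact: (@ex_derive _ _ _ _ _ _ _ (dG x)).
  + by apply: cvg_at_right_filter; exact: cG.
  + by apply: cvg_at_left_filter; exact: cG.
- by move=> x _; rewrite derive1E; exact: (@derive_val _ _ _ _ _ _ _ (dG x)).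
Qed.

End circle_functions.

(** * Cosines on the circle as eigenfunctions *)

Section circle_cosine.
Context {R : realType}.
Implicit Types (m : nat) (x a : R) (z : circle R).

Definition circle_cos m : circle R -> R :=
  circle_lift (fun x => cos (2 * pi * m%:R * x)).

Lemma cos_natfreq_periodic m x :
  cos (2 * pi * m%:R * (x + 1)) = cos (2 * pi * m%:R * x).
Proof.
rewrite (_ : 2 * pi * m%:R * (x + 1) = 2 * pi * m%:R * x + (pi *+ 2) *+ m).
  by rewrite (periodicn (@cosD2pi R)).
by rewrite -(mulr_natr (pi *+ 2)) -(mulr_natr pi); ring.
Qed.

Lemma circle_cosE m x : circle_cos m (to_circle x) = cos (2 * pi * m%:R * x).
Proof. by apply: circle_liftE => y; exact: cos_natfreq_periodic. Qed.

Lemma continuous_cos_freq (w t : R) : continuous (fun x => cos (w * x + t)).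
Proof.
move=> x; apply: continuous_comp; last exact: continuous_cos.
by apply: cvgD; [exact: mulrl_continuous|exact: cvg_cst].
Qed.

Lemma circle_cos_max m z : `|circle_cos m z| <= 1.
Proof. exact: cos_max. Qed.

Lemma measurable_circle_cos m : measurable_fun [set: circle R] (circle_cos m).
Proof.
apply: measurable_circle_lift => [y|]; first exact: cos_natfreq_periodic.
by have := continuous_cos_freq (2 * pi * m%:R) 0; under eq_fun do rewrite addr0.
Qed.

Lemma to_circleB x a : to_circle (x - a) = to_circle x - to_circle a.
Proof. by apply/eqP; rewrite eq_sym subr_eq -to_circleD subrK. Qed.

(** Halving both sides gives the eigenvalue relation for the transition kernel. *)
Lemma circle_cos_translate m z a :
  circle_cos m (z + to_circle a) + circle_cos m (z - to_circle a) =
  2 * cos (2 * pi * m%:R * a) * circle_cos m z.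
Proof.
rewrite -(to_circleK z) -to_circleD -to_circleB !circle_cosE.
by rewrite mulrDr mulrBr cosD cosB; ring.
Qed.

Lemma mean_circle_cos m : (0 < m)%N ->
  \int[circle_lebesgue]_z circle_cos m z = 0.
Proof.
move=> m0; pose w : R := 2 * pi * m%:R.
have w0 : w != 0 by rewrite /w !mulf_neq0// ?gt_eqF ?pi_gt0 ?ltr0n.
have dF x : is_derive x 1 (fun x : R => w^-1 * sin (w * x)) (cos (w * x)).
  have d1 : is_derive x 1 ( *%R w : R -> R) w.
    apply: (@is_derive_quadratic _ _ _ _ 0) => h.
    by rewrite mul0r normr_le0; apply/eqP; ring.
  have d2 := @is_derive1_comp _ sin ( *%R w : R -> R) _ _ _ (is_derive_sin _) d1.
  have := @is_deriveZ _ _ _ _ w^-1 _ _ _ d2.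
  by rewrite /GRing.scale/= mulrCA mulVf// mulr1.
have cw : continuous (fun x => cos (w * x)).
  by have := continuous_cos_freq w 0; under eq_fun do rewrite addr0.
rewrite (@mean_circle_lift _ _ _ 1 (cos_natfreq_periodic m) cw (fun=> cos_max _) dF).
rewrite mulr1 mulr0 (_ : w = 0 + (pi *+ 2) *+ m).
  by rewrite (periodicn (@sinD2pi R)) sin0 mulr0 subrr.
by rewrite /w -(mulr_natr (pi *+ 2)) -(mulr_natr pi); ring.
Qed.

Lemma circle_cos_sqr m z : circle_cos m z ^+ 2 = (1 + circle_cos (2 * m) z) / 2.
Proof.
rewrite -(to_circleK z) !circle_cosE.
rewrite (_ : 2 * pi * (2 * m)%:R * _ = (2 * pi * m%:R * repr z) *+ 2).
  by rewrite cos_mulr2n; field.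
by rewrite natrM -mulr_natr; ring.
Qed.

End circle_cosine.

(** * Correlations along the walk *)

Section circle_random_walk.
Context {R : realType} (alpha : R) {d} {Omega : measurableType d}
  (P : probability Omega R) (Y : nat -> {RV P >-> circle R}).
Hypothesis walkY : markov_process (circle_walk alpha) circle_lebesgue Y.
Implicit Types (h : circle R -> R) (B : set Omega) (m i j n : nat).

Local Notation past j B :=
  (<<s \bigcup_(k in [set k | (k <= j)%N]) g_sigma_algebra_preimage (Y k) >> B).
Local Notation a := (to_circle alpha).
Local Notation c m := (cos (2 * pi * m%:R * alpha)).

Lemma past_preimage i j (A : set (circle R)) :
  (i <= j)%N -> measurable A -> past j (Y i @^-1` A).
Proof.
move=> ij mA; apply: sub_sigma_algebra; exists i => //.
by exists A => //; rewrite setTI.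
Qed.

Lemma past_measurable j B : past j B -> measurable B.
Proof.
move=> pB; apply: (smallest_sub _ _ pB); first exact: sigma_algebra_measurable.
move=> _ [k _ [A mA <-]]; exact: (@measurable_funPT _ _ _ _ (Y k)).
Qed.

Lemma bounded_rv_comp h (X : Omega -> circle R) M :
  measurable_fun [set: circle R] h -> (forall z, `|h z| <= M) ->
  measurable_fun [set: Omega] X -> bounded_rv (h \o X).
Proof.
by move=> mh hM mX; split; [exact: measurableT_comp | exists M => w; exact: hM].
Qed.

Lemma bounded_rv_cos m j : bounded_rv (fun w => circle_cos m (Y j w)).
Proof.
apply: (bounded_rv_comp _ (Y j) 1) => //; first exact: measurable_circle_cos.
exact: circle_cos_max.
Qed.

(** The Markov property speaks of indicators of sets; approximation by level sets carries it over to
    functions with values in [[0, 1]]. *)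
Lemma mean_walk_step j B h : past j B ->
  measurable_fun [set: circle R] h -> (forall z, 0 <= h z <= 1) ->
  \int[P]_w (h (Y j.+1 w) * \1_B w) =
  2^-1 * \int[P]_w (h (Y j w + a) * \1_B w) +
  2^-1 * \int[P]_w (h (Y j w - a) * \1_B w).
Proof.
move=> pB mh h01.
have mB := past_measurable _ _ pB.
have mY k : measurable_fun [set: Omega] (Y k) by exact: measurable_funPT.
have mshift b : measurable_fun [set: Omega] (fun w => Y j w + b).
  exact: (measurableT_comp (measurable_circle_addr b)).
(* The identity becomes a vanishing signed sum of three terms: the next position with weight [1] and
   its two possible values with weight [- 2^-1] each. *)
pose X (i : 'I_3) : Omega -> circle R := fun w =>
  match val i with 0%N => Y j.+1 w | 1%N => Y j w + a | _ => Y j w - a end.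
pose b (i : 'I_3) : R := match val i with 0%N => 1 | _ => - 2^-1 end.
have mX (i : 'I_3) : measurable_fun [set: Omega] (X i).
  by case: i => -[|[|[|//]]] Hi; rewrite /X/=; [exact: mY|exact: mshift|exact: mshift].
have hn z : `|h z| <= 1 by have /andP[? ?] := h01 z; rewrite ger0_norm.
have bhX (i : 'I_3) : bounded_rv (h \o X i) by exact: (bounded_rv_comp h (X i) 1).
have b1B : bounded_rv (\1_B : Omega -> R) by exact: bounded_rv_indic.
have S3 (F : 'I_3 -> R) : \sum_i F i = F ord0 + F (lift ord0 ord0) + F (lift ord0 (lift ord0 ord0)).
  by rewrite !big_ord_recl big_ord0 addr0 addrA.
have := mean_layer_cake P 3 (fun i : 'I_3 => h \o X i) (fun (i : 'I_3) w => b i * \1_B w) bhX.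
move=> /(_ (fun (i : 'I_3) w => h01 _) (fun i : 'I_3 => bounded_rvZ _ _ b1B)).
rewrite !S3.
have bh b' : bounded_rv (fun w => h (Y j w + b') * \1_B w).
  by apply: bounded_rvM => //; exact: (bounded_rv_comp h _ 1).
have -> : \int[P]_w ((h \o X ord0) w * (b ord0 * \1_B w)) = \int[P]_w (h (Y j.+1 w) * \1_B w).
  by apply: eq_Rintegral => w _; rewrite /= /X /b/= mul1r.
have -> : \int[P]_w ((h \o X (lift ord0 ord0)) w * (b (lift ord0 ord0) * \1_B w)) =
    - 2^-1 * \int[P]_w (h (Y j w + a) * \1_B w).
  by rewrite -meanZ//; apply: eq_Rintegral => w _; rewrite /= /X /b/= mulrCA.
have -> : \int[P]_w ((h \o X (lift ord0 (lift ord0 ord0))) w *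
      (b (lift ord0 (lift ord0 ord0)) * \1_B w)) =
    - 2^-1 * \int[P]_w (h (Y j w - a) * \1_B w).
  by rewrite -meanZ//; apply: eq_Rintegral => w _; rewrite /= /X /b/= mulrCA.
move=> H; suff : forall t,
    \sum_i \int[P]_w (\1_((h \o X i) @^-1` `[t, +oo[) w * (b i * \1_B w)) = 0.
  by move=> /H; lra.
move=> t {H}.
set A := h @^-1` `[t, +oo[.
have mA : measurable A by rewrite -[A]setTI; exact: mh.
have mXA (i : 'I_3) : measurable (X i @^-1` A).
  by rewrite -[X in measurable X]setTI; exact: mX.
have E (i : 'I_3) : \int[P]_w (\1_((h \o X i) @^-1` `[t, +oo[) w * (b i * \1_B w)) =
    b i * fine (P (B `&` X i @^-1` A)).
  rewrite -mean_indic; last exact: measurableI.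
  rewrite -meanZ; last by apply: bounded_rv_indic; exact: measurableI.
  by apply: eq_Rintegral => w _; rewrite comp_preimage mulrCA indicI /= (mulrC (\1_B w)).
rewrite S3 !E /b/= /X/=.
have mshiftA b' : measurable (B `&` (fun w => Y j w + b') @^-1` A).
  by apply: measurableI => //; rewrite -[X in measurable X]setTI; exact: mshift.
(* For a single level set [A] the identity is the Markov property itself, with the kernel written
   out as two half Dirac masses. *)
have -> : fine (P (B `&` Y j.+1 @^-1` A)) =
    2^-1 * fine (P (B `&` (fun w => Y j w + a) @^-1` A)) +
    2^-1 * fine (P (B `&` (fun w => Y j w - a) @^-1` A)).
  rewrite walkY.2// -!mean_indic// -!meanZ; try exact: bounded_rv_indic.
  rewrite -meanD; try by apply: bounded_rvZ; exact: bounded_rv_indic.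
  transitivity (\int[P]_(w in B) (2^-1 * \1_A (Y j w + a) + 2^-1 * \1_A (Y j w - a))).
    congr fine; apply: eq_integral => w _.
    have half z : mscale (2^-1)%:nng (\d_z : {measure set (circle R) -> \bar R}) A =
        (2^-1 * \1_A z)%:E by [].
    by rewrite [LHS]measure_addE [X in (X + _)%E]half [X in (_ + X)%E]half.
  rewrite Rintegral_mkcond; apply: eq_Rintegral => w _.
  rewrite patch_indic /= !indicI /= !indicE /=.
  by rewrite mulrDl -!mulrA ![_ * (w \in B)%:R]mulrC.
by ring.
Qed.

End circle_random_walk.

(** * Second moments of cosines along the walk *)

Section walk_correlations.
Context {R : realType} (alpha : R) {d} {Omega : measurableType d}
  (P : probability Omega R) (Y : nat -> {RV P >-> circle R}).
Hypothesis walkY : markov_process (circle_walk alpha) circle_lebesgue Y.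
Implicit Types (B : set Omega) (m i j n : nat).

Local Notation past j B :=
  (<<s \bigcup_(k in [set k | (k <= j)%N]) g_sigma_algebra_preimage (Y k) >> B).
Local Notation a := (to_circle alpha).
Local Notation c m := (cos (2 * pi * m%:R * alpha)).
Local Notation e m j := (fun w => circle_cos m (Y j w)).

Let bcos m j : bounded_rv (e m j). Proof. exact: bounded_rv_cos. Qed.

(** The affine change [h] brings the cosine into [[0, 1]], where the one-step formula applies; the
    two translates then combine into the eigenvalue. *)
Lemma mean_cos_step_past m j B : past j B ->
  \int[P]_w (circle_cos m (Y j.+1 w) * \1_B w) =
  c m * \int[P]_w (circle_cos m (Y j w) * \1_B w).
Proof.
move=> pB.
have b1B : bounded_rv (\1_B : Omega -> R).
  by apply: bounded_rv_indic; exact: (past_measurable P Y _ _ pB).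
pose h (z : circle R) : R := (1 + circle_cos m z) / 2.
have h01 z : 0 <= h z <= 1.
  have := circle_cos_max m z; rewrite ler_norml => /andP[? ?].
  by rewrite /h; apply/andP; split; lra.
have mh : measurable_fun [set: circle R] h.
  apply: measurable_funM => //; apply: measurable_funD => //.
  exact: measurable_circle_cos.
have bhX (X : Omega -> circle R) : measurable_fun [set: Omega] X ->
    bounded_rv (fun w => h (X w) * \1_B w).
  move=> mX; apply: bounded_rvM => //; apply: (bounded_rv_comp h X 1) => // z.
  by have /andP[? ?] := h01 z; rewrite ger0_norm.
have mshift b : measurable_fun [set: Omega] (fun w => Y j w + b).
  exact: (measurableT_comp (measurable_circle_addr b)).
have mY k : measurable_fun [set: Omega] (Y k) by exact: measurable_funPT.
have E k : \int[P]_w (circle_cos m (Y k w) * \1_B w) =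
    2 * \int[P]_w (h (Y k w) * \1_B w) - \int[P]_w \1_B w.
  rewrite -meanZ; last exact: bhX.
  rewrite -meanB//; last by apply: bounded_rvZ; exact: bhX.
  by apply: eq_Rintegral => w _; rewrite /h; field.
rewrite E (mean_walk_step alpha P Y walkY j B h pB mh h01) -mulrDr.
rewrite -meanD; [|exact: bhX|exact: bhX].
rewrite mulrA mulfV// mul1r -meanB//; last exact: bounded_rvD (bhX _ _) (bhX _ _).
rewrite -meanZ; last exact: bounded_rvM.
apply: eq_Rintegral => w _.
have := circle_cos_translate m (Y j w) alpha; rewrite /h => H.
transitivity (((circle_cos m (Y j w + a) + circle_cos m (Y j w - a)) / 2) * \1_B w).
  by field.
by rewrite H; field.
Qed.

Lemma mean_cos_step m j :
  \int[P]_w circle_cos m (Y j.+1 w) = c m * \int[P]_w circle_cos m (Y j w).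
Proof.
have pT : past j [set: Omega].
  rewrite -(preimage_setT (Y j)); apply: past_preimage => //.
have E k : \int[P]_w circle_cos m (Y k w) =
    \int[P]_w (circle_cos m (Y k w) * \1_[set: Omega] w).
  by apply: eq_Rintegral => w _; rewrite indicT mulr1.
by rewrite !E (mean_cos_step_past m j _ pT).
Qed.

(** The innovation [xi] integrates to zero over every event of the past up to [j], in particular
    over level sets of functions of [Y i]; approximation by such sets makes it orthogonal to the
    cosine at time [i]. *)
Lemma mean_cosM_step m i j : (i <= j)%N ->
  \int[P]_w (circle_cos m (Y i w) * circle_cos m (Y j.+1 w)) =
  c m * \int[P]_w (circle_cos m (Y i w) * circle_cos m (Y j w)).
Proof.
move=> ij.
pose h (z : circle R) : R := (1 + circle_cos m z) / 2.
pose xi w := circle_cos m (Y j.+1 w) - c m * circle_cos m (Y j w).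
have bxi : bounded_rv xi by exact: bounded_rvB (bcos _ _) (bounded_rvZ _ _ (bcos _ _)).
have h01 z : 0 <= h z <= 1.
  have := circle_cos_max m z; rewrite ler_norml => /andP[? ?].
  by rewrite /h; apply/andP; split; lra.
have mh : measurable_fun [set: circle R] h.
  apply: measurable_funM => //; apply: measurable_funD => //.
  exact: measurable_circle_cos.
have bh : bounded_rv (h \o Y i).
  apply: (bounded_rv_comp h (Y i) 1) => // z.
  by have /andP[? ?] := h01 z; rewrite ger0_norm.
have := mean_layer_cake P 1 (fun=> h \o Y i) (fun=> xi) (fun=> bh)
  (fun=> fun w => h01 _) (fun=> bxi).
rewrite big_ord1 => H.
have xi0 : \int[P]_w xi w = 0.
  by rewrite meanB ?meanZ// ?mean_cos_step ?subrr//; exact: bounded_rvZ.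
have {}H : \int[P]_w ((h \o Y i) w * xi w) = 0.
  apply: H => t; rewrite big_ord1.
  set B := _ @^-1` _.
  have pB : past j B.
    rewrite /B comp_preimage; apply: past_preimage => //.
    by rewrite -[X in measurable X]setTI; exact: mh.
  have b1B : bounded_rv (\1_B : Omega -> R).
    by apply: bounded_rv_indic; exact: (past_measurable P Y _ _ pB).
  transitivity (\int[P]_w (circle_cos m (Y j.+1 w) * \1_B w -
      c m * (circle_cos m (Y j w) * \1_B w))).
    by apply: eq_Rintegral => w _; rewrite /xi; ring.
  rewrite meanB; [|exact: bounded_rvM|by apply: bounded_rvZ; exact: bounded_rvM].
  by rewrite meanZ ?mean_cos_step_past ?subrr//; exact: bounded_rvM.
apply/eqP; rewrite -subr_eq0 -meanZ; last exact: bounded_rvM.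
rewrite -meanB; [|exact: bounded_rvM|by apply: bounded_rvZ; exact: bounded_rvM].
apply/eqP; transitivity (\int[P]_w (2 * ((h \o Y i) w * xi w) - xi w)).
  by apply: eq_Rintegral => w _; rewrite /xi /h/=; field.
rewrite meanB// ?meanZ ?H ?xi0 ?mulr0 ?subrr//; first exact: bounded_rvM.
by apply: bounded_rvZ; exact: bounded_rvM.
Qed.

(** The mean vanishes under the initial Lebesgue law, and each step multiplies it by the
    eigenvalue. *)
Lemma mean_cos0 m j : (0 < m)%N -> \int[P]_w circle_cos m (Y j w) = 0.
Proof.
move=> m0; elim: j => [|j IH]; last by rewrite mean_cos_step IH mulr0.
rewrite -(mean_circle_cos m m0) /Rintegral; congr fine.
rewrite -[LHS](integral_distribution (f := fun z => (circle_cos m z)%:E)).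
- apply: eq_measure_integral => A mA _; exact: walkY.1.
- by apply/measurable_EFinP; exact: measurable_circle_cos.
- exact: (bounded_rv_integrable P _ (bcos m 0)).
Qed.

Lemma mean_cos_sqr m j : (0 < m)%N ->
  \int[P]_w circle_cos m (Y j w) ^+ 2 = 2^-1.
Proof.
move=> m0.
transitivity (\int[P]_w (2^-1 + 2^-1 * circle_cos (2 * m) (Y j w))).
  by apply: eq_Rintegral => w _; rewrite circle_cos_sqr; field.
rewrite meanD; [|exact: bounded_rv_cst|exact: bounded_rvZ].
by rewrite mean_cst meanZ// mean_cos0 ?mulr0 ?addr0// muln_gt0.
Qed.

(** The correlation at lag [n] is [c ^+ n / 2], so the left side equals [1 - c ^+ n]; a
    Bernoulli-type induction concludes. When [c] is near [1], the cosine stays almost frozen for a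
    long time. *)
Lemma mean_cos_increment_sqr m n : (0 < m)%N ->
  \int[P]_w (circle_cos m (Y n w) - circle_cos m (Y 0%N w)) ^+ 2 <= n%:R * (1 - c m).
Proof.
move=> m0.
have E : \int[P]_w (circle_cos m (Y 0%N w) * circle_cos m (Y n w)) = c m ^+ n / 2.
  elim: n => [|n IH]; last by rewrite mean_cosM_step// IH exprS mulrA.
  by rewrite expr0 mul1r -(mean_cos_sqr m 0).
have -> : \int[P]_w (circle_cos m (Y n w) - circle_cos m (Y 0%N w)) ^+ 2 = 1 - c m ^+ n.
  transitivity (\int[P]_w (circle_cos m (Y n w) ^+ 2 + circle_cos m (Y 0%N w) ^+ 2 -
      2 * (circle_cos m (Y 0%N w) * circle_cos m (Y n w)))).
    by apply: eq_Rintegral => w _; ring.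
  have b2 k : bounded_rv (fun w => circle_cos m (Y k w) ^+ 2) by exact: bounded_rvX.
  rewrite meanB; [|exact: bounded_rvD|by apply: bounded_rvZ; exact: bounded_rvM].
  by rewrite meanD// meanZ ?E ?mean_cos_sqr//; [field | exact: bounded_rvM].
elim: n {E} => [|n IH]; first by rewrite expr0 subrr mul0r.
have cn : `|c m ^+ n| <= 1 by rewrite normrX exprn_ile1// cos_max.
have : c m ^+ n * (1 - c m) <= 1 * (1 - c m).
  by rewrite ler_wpM2r// ?subr_ge0 ?cos_le1// (le_trans (ler_norm _)).
by rewrite exprS -[n.+1%:R]natr1; move: IH; lra.
Qed.

(* With S_n the partial sum and W_n = E[S_n e_m(Y_n)], the eigenvalue relation
   gives W_(n+1) = c (W_n + 1/2), so W_n stays bounded, and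
   E[S_(n+1)^2] = E[S_n^2] + 2 W_n + 1/2. *)
Lemma mean_cos_sum_sqr m n : (0 < m)%N -> `|c m| < 1 ->
  \int[P]_w (\sum_(k < n) circle_cos m (Y k w)) ^+ 2 <=
  n%:R * (1 + 2 / (1 - `|c m|)).
Proof.
move=> m0 c1.
pose S n w := \sum_(k < n) circle_cos m (Y k w).
have bS k : bounded_rv (S k) by exact: (bounded_rv_sum _ (fun i => e m i)).
pose W n := \int[P]_w (S n w * circle_cos m (Y n w)).
have WE k : W k.+1 = c m * (W k + 2^-1).
  rewrite -(mean_cos_sqr m k m0) /W.
  have E l : \int[P]_w (S k.+1 w * circle_cos m (Y l w)) =
      \sum_(i < k.+1) \int[P]_w (circle_cos m (Y i w) * circle_cos m (Y l w)).
    rewrite -(mean_sum P k.+1 (fun i w => circle_cos m (Y i w) * circle_cos m (Y l w))).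
      by apply: eq_Rintegral => w _; rewrite /S mulr_suml.
    by move=> i; exact: bounded_rvM.
  rewrite E -meanD; [|exact: bounded_rvM|exact: bounded_rvX].
  have -> : \int[P]_w (S k w * circle_cos m (Y k w) + circle_cos m (Y k w) ^+ 2) =
      \int[P]_w (S k.+1 w * circle_cos m (Y k w)).
    by apply: eq_Rintegral => w _; rewrite /S big_ord_recr/= mulrDl expr2.
  rewrite E mulr_sumr; apply: eq_bigr => i _; rewrite mean_cosM_step//.
  by rewrite -ltnS.
have q0 : 0 < 1 - `|c m| by rewrite subr_gt0.
have Wb k : `|W k| <= (1 - `|c m|)^-1.
  elim: k => [|k IH].
    rewrite /W; under eq_Rintegral do rewrite /S big_ord0 mul0r.
    by rewrite mean_cst normr0 invr_ge0 ltW.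
  rewrite WE normrM.
  have h : `|W k + 2^-1| <= (1 - `|c m|)^-1 + 1.
    by rewrite (le_trans (ler_normD _ _))// lerD// ger0_norm; lra.
  apply: (le_trans (ler_wpM2l (normr_ge0 _) h)).
  have := mulVf (negbT (gt_eqF q0)); move: q0; set y := _^-1; set x := `|c m|.
  by lra.
elim: n => [|n IH].
  by under eq_Rintegral do rewrite big_ord0 expr0n/=; rewrite mean_cst mul0r.
have -> : \int[P]_w (\sum_(k < n.+1) circle_cos m (Y k w)) ^+ 2 =
    \int[P]_w (S n w) ^+ 2 + 2 * W n + 2^-1.
  rewrite -(mean_cos_sqr m n m0) /W -meanZ; last exact: bounded_rvM.
  have b1 := bounded_rvX _ 2 (bS n).
  have b2 := bounded_rvZ 2 _ (bounded_rvM _ _ (bS n) (bcos m n)).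
  have b3 := bounded_rvX _ 2 (bcos m n).
  rewrite -meanD// -meanD//; last exact: bounded_rvD.
  by apply: eq_Rintegral => w _; rewrite big_ord_recr/= -/(S n w); ring.
have := ler_norm (W n); have := Wb n; move: IH; rewrite -/(S n) -[n.+1%:R]natr1.
set x := `|W n|; set y := (1 - _)^-1; set z := \int[P]_w _; lra.
Qed.

End walk_correlations.

(** * Good frequencies *)

Section arithmetic.
Context {R : realType}.
Implicit Types (alpha c gamma : R) (m s N : nat).

(** The square is 1-periodic, so [x] may be replaced by its fractional part, which lies strictly
    between [0] and [1]. *)
Lemma sin_pi_neq0 (x : R) : x \isn't a Num.int -> sin (pi * x) != 0.
Proof.
move=> xint.
pose f := fun y : R => sin (pi * y) ^+ 2.
have f1 y : f (y + 1) = f y.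
  by rewrite /f mulrDr mulr1 sinDpi sqrrN.
suff : f x != 0 by rewrite expf_eq0.
rewrite -(subrK (Num.floor x)%:~R x) periodic_int// expf_eq0/= gt_eqF//.
apply: sin_gt0_pi; set t := x - _.
have t0 : 0 < t.
  rewrite subr_gt0 lt_neqAle floor_le andbT.
  by apply: contra xint => /eqP <-; exact: intr_int.
have t1 : t < 1 by rewrite ltrBlDl -intrD1; exact: floorD1_gt.
by rewrite mulr_gt0 ?pi_gt0//= gtr_pMr// pi_gt0.
Qed.

(** Equality would make [2 * m * alpha] an integer. *)
Lemma norm_cos_irrational_lt1 alpha m : irrational alpha -> (0 < m)%N ->
  `|cos (2 * pi * m%:R * alpha)| < 1.
Proof.
move=> irr m0; rewrite lt_neqAle cos_max andbT norm_cos_eq1.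
rewrite (_ : 2 * pi * m%:R * alpha = pi * ((2 * m)%:R * alpha)); last by rewrite natrM; ring.
apply: sin_pi_neq0; apply/negP => /intrP[p Hp]; apply: irr.
apply/rationalP; exists p, (2 * m)%N.
by rewrite -Hp mulrAC mulfV ?mul1r// pnatr_eq0 muln_eq0 -lt0n.
Qed.

Lemma finite_int_ball N : finite_set [set z : int | (`|z| <= N)%N].
Proof.
apply: (@sub_finite_set _ _ ((fun n : nat => n%:Z) @` `I_N.+1 `|`
                             (fun n : nat => - n%:Z) @` `I_N.+1)).
  move=> z /= zN; have [z0|z0] := leP 0 z.
    by left; exists `|z|%N; rewrite ?gez0_abs.
  by right; exists `|z|%N; rewrite ?ltz0_abs ?opprK.
by rewrite finite_setU; split; apply: finite_image; exact: finite_II.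
Qed.

(** An approximation lies within [c] of [alpha], so a bound on [q] also bounds [p]; only finitely
    many pairs have a small denominator. *)
Lemma large_denominator alpha c gamma N : 0 < c -> 0 <= gamma ->
  infinite_set [set pq : int * int | pq.2 != 0 /\
    `|alpha - pq.1%:~R / pq.2%:~R| <= c / (`|pq.2%:~R| `^ gamma)] ->
  exists p q : int, [/\ (N <= `|q|)%N, q != 0 &
    `|alpha - p%:~R / q%:~R| <= c / (`|q%:~R| `^ gamma)].
Proof.
move=> c0 g0 inf; apply: contrapT => H; apply: inf.
pose M := (Num.truncn (N%:R * (`|alpha| + c))).+1.
apply: (@sub_finite_set _ _ ([set z : int | (`|z| <= M)%N] `*`
                             [set z : int | (`|z| <= N)%N])); last first.
  by apply: finite_setX; exact: finite_int_ball.
move=> [p q] /= [q0 Hq].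
have qN : (`|q| < N)%N.
  by rewrite ltnNge; apply/negP => Nq; apply: H; exists p, q.
split => /=; last exact: ltnW.
have q1 : 1 <= `|q%:~R : R| by rewrite -intr_norm ler1z -gtz0_ge1 normr_gt0.
have qR0 : 0 < `|q%:~R : R| by exact: lt_le_trans q1.
have pg1 : 1 <= `|q%:~R : R| `^ gamma.
  by rewrite -[leLHS](powRr0 `|q%:~R : R|) ler_powR.
have h1 : `|alpha - p%:~R / q%:~R| <= c.
  by rewrite (le_trans Hq)// ler_pdivrMr ?(lt_le_trans ltr01)// ler_peMr// ltW.
have h2 : `|p%:~R / q%:~R : R| <= `|alpha| + c.
  rewrite -[X in `|X|](subKr alpha) (le_trans (ler_normB _ _))// lerD2l//.
rewrite normrM normfV ler_pdivrMr// mulrC in h2.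
rewrite -(@ler_nat R) (le_trans _ (ltW (truncnS_gt _)))//.
rewrite natr_absz intr_norm (le_trans h2)// ler_wpM2r ?addr_ge0 ?(ltW c0)//.
by rewrite -intr_norm -natr_absz ler_nat ltnW.
Qed.

(** For [m = |q|], the number [m * alpha] is within [c / m ^+ s.+1] of an integer, so [1 - cos] is
    of order [m] to the power [-(2 * s + 2)]. The product with [m ^+ (2 * s)] is of order [m] to the
    power [-2]. *)
Lemma good_frequency alpha c gamma s N (L eps : R) :
  0 < c -> s.+2%:R <= gamma -> 0 < eps -> 0 <= L ->
  infinite_set [set pq : int * int | pq.2 != 0 /\
    `|alpha - pq.1%:~R / pq.2%:~R| <= c / (`|pq.2%:~R| `^ gamma)] ->
  exists m, [/\ (N <= m)%N, (0 < m)%N &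
    L * m%:R ^+ (2 * s) * (1 - cos (2 * pi * m%:R * alpha)) <= eps].
Proof.
move=> c0 sg eps0 L0 inf.
have g0 : 0 <= gamma by apply: le_trans sg; rewrite ler0n.
pose K := L * (2 * pi * c) ^+ 2.
have K0 : 0 <= K by rewrite mulr_ge0// sqr_ge0.
(* The second bound ensures [K / eps <= m], whence [K / m ^+ 2 <= eps] because [1 <= m]. *)
pose N' := maxn N (Num.truncn (K / eps)).+1.
have [p [q [Nq q0 Hq]]] := large_denominator alpha c gamma N' c0 g0 inf.
move: Nq; rewrite geq_max => /andP[Nq Kq].
exists `|q|%N; split => //; first by rewrite absz_gt0.
set m := `|q|%N in Nq Kq *.
have m0 : (0 < m)%N by rewrite absz_gt0.
have mR : m%:R = `|q%:~R : R| by rewrite natr_absz intr_norm.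
have mR1 : 1 <= m%:R :> R by rewrite ler1n.
have mR0 : 0 < m%:R :> R by rewrite ltr0n.
have pow : m%:R ^+ s.+2 <= `|q%:~R : R| `^ gamma.
  by rewrite -powR_mulrn ?ler0n// -mR ler_powR.
have Hq2 : `|q%:~R * alpha - p%:~R| <= c / m%:R ^+ s.+1.
  have -> : q%:~R * alpha - p%:~R = q%:~R * (alpha - p%:~R / q%:~R) :> R.
    by field; rewrite intr_eq0.
  rewrite normrM -mR ler_pdivlMr ?exprn_gt0//.
  have h : `|alpha - p%:~R / q%:~R| <= c / m%:R ^+ s.+2.
    by rewrite (le_trans Hq)// ler_wpM2l ?(ltW c0)// lef_pV2//
      posrE ?exprn_gt0// (lt_le_trans _ pow)// exprn_gt0.
  rewrite ler_pdivlMr ?exprn_gt0// in h.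
  by rewrite mulrAC -exprS mulrC.
(* Evenness of cosine absorbs the sign of [q], and periodicity absorbs [p]. *)
have cosE : cos (2 * pi * m%:R * alpha) = cos (2 * pi * (q%:~R * alpha - p%:~R)).
  have -> : cos (2 * pi * m%:R * alpha) = cos (2 * pi * (q%:~R * alpha)).
    rewrite mR; have [q_ge0|q_lt0] := leP 0 q.
      by rewrite ger0_norm ?ler0z// mulrA.
    by rewrite ltr0_norm ?ltrz0// -cosN; congr cos; ring.
  have f1 (y : R) : cos (2 * pi * (y + 1)) = cos (2 * pi * y).
    by have := cos_natfreq_periodic 1 y; rewrite mulr1.
  rewrite -[X in _ = cos (2 * pi * X)](_ : q%:~R * alpha + (- p)%:~R = _); last by rewrite mulrNz.
  by rewrite (periodic_int (fun y => cos (2 * pi * y))).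
have h1 : 1 - cos (2 * pi * m%:R * alpha) <= (2 * pi * c) ^+ 2 / (m%:R ^+ s.+1) ^+ 2.
  rewrite cosE (le_trans (one_sub_cos_le _))// -expr_div_n.
  rewrite -(real_normK (num_real (2 * pi * _))) lerXn2r ?nnegrE//.
    by rewrite !mulr_ge0 ?invr_ge0 ?pi_ge0 ?(ltW c0).
  rewrite normrM -[leRHS]mulrA ger0_norm ?mulr_ge0 ?pi_ge0//.
  by rewrite ler_wpM2l// mulr_ge0 ?pi_ge0.
apply: (@le_trans _ _ (K / m%:R ^+ 2)).
  apply: (le_trans (ler_wpM2l _ h1)); first by rewrite mulr_ge0// exprn_ge0// ltW.
  have -> : (m%:R ^+ s.+1) ^+ 2 = m%:R ^+ 2 * m%:R ^+ (2 * s) :> R.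
    by rewrite -exprM mulnC mulnS exprD.
  rewrite /K le_eqVlt; apply/orP; left; apply/eqP.
  by field; rewrite ?expf_neq0// gt_eqF.
rewrite ler_pdivrMr ?exprn_gt0//.
apply: (@le_trans _ _ (eps * m%:R)).
  rewrite mulrC -ler_pdivrMr//; apply/ltW/(lt_le_trans (truncnS_gt _)).
  by rewrite ler_nat.
by rewrite ler_wpM2l ?(ltW eps0)// ler_eXnr.
Qed.

(** Recursive choice in which each term may depend on its index and on the total cost [v] of the
    terms already chosen. *)
Lemma gliding_sequence (v : nat -> R) (good : nat -> R -> nat -> Prop) :
  (forall K D N, exists m, (N <= m)%N /\ good K D m) ->
  exists m : nat -> nat, (forall K, (m K <= m K.+1)%N) /\
    forall K, good K (\sum_(k < K) v (m k)) (m K).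
Proof.
move=> H.
have /choice[next Hn] : forall x : nat * R * nat, exists m,
    (x.2 <= m)%N /\ good x.1.1 x.1.2 m by move=> x; exact: H.
(* The state records the index, the accumulated cost and the last term chosen; the initial last term
   [0] imposes no lower bound. *)
pose st := fix st K : nat * R * nat := if K is K'.+1 then
  (K, (st K').1.2 + v (next (st K')), next (st K')) else (0%N, 0, 0%N).
have st1 K : (st K).1 = (K, \sum_(k < K) v (next (st k))).
  elim: K => [|K IH]; first by rewrite big_ord0.
  by rewrite big_ord_recr/= IH.
exists (fun K => next (st K)); split => K.
  by have [] := Hn (st K.+1).
by have [_] := Hn (st K); rewrite st1.
Qed.

End arithmetic.

(** * Detecting loss of tightness *)

Section plateau.
Context {R : realType}.
Implicit Types (M x : R).

(** A piecewise linear substitute for the indicator of [[-M, M]], admissible as a test function for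
    convergence in distribution. *)
Definition plateau M x : R := Num.max 0 (Num.min 1 (M + 1 - `|x|)).

Lemma plateau_ge0 M x : 0 <= plateau M x.
Proof. by rewrite le_max lexx. Qed.

Lemma plateau_le1 M x : plateau M x <= 1.
Proof. by rewrite ge_max ler01 ge_min lexx. Qed.

Lemma plateau_eq1 M x : `|x| <= M -> plateau M x = 1.
Proof. by move=> xM; rewrite /plateau min_l ?max_r//; lra. Qed.

Lemma plateau_eq0 M x : M + 1 <= `|x| -> plateau M x = 0.
Proof. by move=> xM; rewrite /plateau max_l// ge_min subr_le0 xM orbT. Qed.

Lemma continuous_plateau M : continuous (plateau M).
Proof.
move=> x; apply: (@continuous_max R R (fun=> 0) (fun x => Num.min 1 (M + 1 - `|x|))).
  exact: cvg_cst.
apply: (@continuous_min R R (fun=> 1) (fun x => M + 1 - `|x|)); first exact: cvg_cst.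
by apply: cvgB; [exact: cvg_cst|exact: norm_continuous].
Qed.

Lemma measurable_plateau M : measurable_fun [set: R] (plateau M).
Proof. by apply: continuous_measurable_fun; exact: continuous_plateau. Qed.

(** The intervals [[-n, n]] exhaust the line, so their measures tend to [1], and the plateau
    dominates the indicator. *)
Lemma integral_plateau_gt (mu : probability (measurableTypeR R) R) (r : R) :
  r < 1 -> exists M : nat, (r%:E < \int[mu]_x (plateau M%:R x)%:E)%E.
Proof.
move=> r1.
pose F (n : nat) : set (measurableTypeR R) := `[- n%:R, n%:R]%classic.
have mF n : measurable (F n) by exact: measurable_itv.
have FT : \bigcup_n F n = [set: R].
  apply/seteqP; split => // x _; exists (Num.truncn `|x|).+1 => //=.
  by rewrite /F/= in_itv/= -ler_norml ltW// truncnS_gt.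
have Fcvg : mu (F n) @[n --> \oo] --> 1%E.
  rewrite -(@probability_setT _ _ _ mu) -FT; apply: nondecreasing_cvg_mu => //.
    by rewrite FT.
  move=> n m nm; apply/subsetPset => x; rewrite /F/= !in_itv/= => /andP[h1 h2].
  have : n%:R <= m%:R :> R by rewrite ler_nat.
  by move=> h; apply/andP; split; lra.
have [M _ HM] : \forall n \near \oo, (r%:E < mu (F n))%E.
  apply: (Fcvg [set y | (r%:E < y)%E]); apply: open_nbhs_nbhs; split.
    exact: open_ereal_gt_ereal.
  by rewrite /= lte_fin.
exists M; apply: (lt_le_trans (HM M (leqnn M))).
have -> : mu (F M) = (\int[mu]_x (\1_(F M) x)%:E)%E by rewrite integral_indic ?setIT.
apply: ge0_le_integral => //.
- by apply/measurable_EFinP; exact: measurable_indic.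
- by apply/measurable_EFinP; exact: measurable_plateau.
- move=> x _; rewrite lee_fin indicE.
  case: (boolP (x \in F M)) => xF; last exact: plateau_ge0.
  by rewrite plateau_eq1//; move: xF; rewrite inE /F/= in_itv/= -ler_norml.
Qed.

(** One plateau nearly exhausts the limit law, and convergence against this test function transfers
    the bound to all large [n]. Plateau means of at most [r] along arbitrarily late times thus
    exclude any limit law. *)
Lemma cvg_in_distribution_tight {d} {Omega : measurableType d}
    (P : probability Omega R) (X : nat -> Omega -> R)
    (mu : probability (measurableTypeR R) R) (r : R) :
  (forall n, measurable_fun [set: Omega] (X n)) ->
  cvg_in_distribution P X mu -> r < 1 ->
  exists M N : nat, forall n, (N <= n)%N ->
    r < \int[P]_w plateau M%:R (X n w).
Proof.
move=> mX Xmu r1; have [M HM] := integral_plateau_gt mu r r1.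
have bp : bounded_fun (plateau M%:R).
  exists 1; split; first exact: num_real.
  move=> x x1 y _ /=; rewrite ger0_norm ?plateau_ge0//.
  by rewrite (le_trans (plateau_le1 _ _))// ltW.
have /(_ [set y | (r%:E < y)%E]) := Xmu _ (continuous_plateau M%:R) bp.
case=> [|N _ HN].
  by apply: open_nbhs_nbhs; split => //; exact: open_ereal_gt_ereal.
exists M, N => n Nn; have := HN n Nn; rewrite /= unlock.
have bX : bounded_rv (plateau M%:R \o X n).
  split; last by exists 1 => w; rewrite ger0_norm ?plateau_ge0 ?plateau_le1.
  by apply: measurableT_comp => //; exact: measurable_plateau.
rewrite -[X in (_ < X)%E]fineK ?lte_fin//.
by apply: integrable_fin_num => //; exact: bounded_rv_integrable.
Qed.

End plateau.

(** The deterministic estimate along one trajectory: the [K]-th term is compared with its frozen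
    value [n * e K 0], the earlier terms and the tail are subtracted. Errors enter through squares,
    so that their means reduce to second moments. *)
Lemma hump_lower_bound {R : realType} (n K : nat) (rt : R) (a F : nat -> R)
    (e : nat -> nat -> R) :
  (0 < n)%N -> 0 < rt -> rt ^+ 2 = n%:R -> (forall k, 0 <= a k <= 1) ->
  (forall j, `|F j - \sum_(k < K.+1) a k * e k j| <= a K / 15) ->
  rt * a K * (`|e K 0%N| - 1 / 16 -
    4 * (n%:R^-1 * \sum_(j < n) (e K j - e K 0%N) ^+ 2) - 1 / 15) -
  \sum_(k < K) (1 + (\sum_(j < n) e k j) ^+ 2 / n%:R) / 2 <=
  `|(\sum_(j < n) F j) / rt|.
Proof.
move=> n0 rt0 rtn a01 Fa.
have nR0 : 0 < n%:R :> R by rewrite ltr0n.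
have aK0 : 0 <= a K by have /andP[] := a01 K.
set A := n%:R^-1 * _; set Q := \sum_(k < K) _.
have nA : n%:R * A = \sum_(j < n) (e K j - e K 0%N) ^+ 2.
  by rewrite /A mulrA mulfV ?mul1r// gt_eqF.
have h1 : `|\sum_(j < n) F j - \sum_(j < n) \sum_(k < K.+1) a k * e k j| <=
    n%:R * (a K / 15).
  rewrite -sumrB (le_trans (ler_norm_sum _ _ _))//.
  have -> : n%:R * (a K / 15) = \sum_(j < n) (a K / 15).
    by rewrite sumr_const card_ord mulr_natl.
  by apply: ler_sum => j _; exact: Fa.
have h2 : \sum_(j < n) \sum_(k < K.+1) a k * e k j =
    \sum_(k < K) a k * (\sum_(j < n) e k j) + a K * \sum_(j < n) e K j.
  rewrite exchange_big/= big_ord_recr/= mulr_sumr; congr (_ + _).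
  by apply: eq_bigr => k _; rewrite mulr_sumr.
have h3 : `|\sum_(k < K) a k * (\sum_(j < n) e k j)| <= rt * Q.
  rewrite (le_trans (ler_norm_sum _ _ _))// mulr_sumr; apply: ler_sum => k _.
  set S := \sum_(j < n) _; have /andP[ak0 ak1] := a01 k.
  rewrite normrM (ger0_norm ak0) (@le_trans _ _ `|S|)// ?ler_piMl//.
  rewrite -rtn -(real_normK (num_real S)); set t := `|S|.
  (* AM-GM: t <= (rt + t^2 / rt) / 2 *)
  have -> : rt * ((1 + t ^+ 2 / rt ^+ 2) / 2) = t + (rt - t) ^+ 2 / (2 * rt).
    by field; rewrite gt_eqF.
  by rewrite lerDl mulr_ge0 ?sqr_ge0// invr_ge0 mulr_ge0// ltW.
have h4 : n%:R * (`|e K 0%N| - 1 / 16 - 4 * A) <= `|\sum_(j < n) e K j|.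
  have : `|\sum_(j < n) (e K j - e K 0%N)| <= n%:R * (1 / 16) + 4 * (n%:R * A).
    rewrite nA mulr_sumr (le_trans (ler_norm_sum _ _ _))//.
    have -> : n%:R * (1 / 16) = \sum_(j < n) (1 / 16 : R).
      by rewrite sumr_const card_ord mulr_natl.
    rewrite -big_split/=.
    apply: ler_sum => j _; set x := _ - _.
    rewrite -(real_normK (num_real x)); set t := `|x|.
    (* AM-GM: t <= 1/16 + 4 t^2 *)
    have := sqr_ge0 (8 * t - 1); rewrite -subr_ge0; lra.
  rewrite sumrB sumr_const card_ord -(mulr_natl (e K 0%N)) => h.
  have := ler_normB (\sum_(j < n) e K j) (\sum_(j < n) e K j - n%:R * e K 0%N).
  rewrite subKr normrM ger0_norm// => h'; move: h h'.
  by lra.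
rewrite normrM normfV (ger0_norm (ltW rt0)) ler_pdivlMr//.
have h5 : a K * (n%:R * (`|e K 0%N| - 1 / 16 - 4 * A)) <= `|a K * \sum_(j < n) e K j|.
  by rewrite normrM (ger0_norm aK0) ler_wpM2l.
rewrite h2 in h1.
have E : (rt * a K * (`|e K 0%N| - 1 / 16 - 4 * A - 1 / 15) - Q) * rt =
   a K * (n%:R * (`|e K 0%N| - 1 / 16 - 4 * A)) - n%:R * (a K / 15) - rt * Q.
  by rewrite -rtn; ring.
rewrite E; move: h1 h3 h5.
set S1 := \sum_(k < K) a k * _; set S2 := a K * \sum_(_ < _) _; set S := \sum_(j < n) F j.
set b1 := a K * (n%:R * _); set b2 := n%:R * _; set b3 := rt * Q.
move=> h1 h3 h5.
(* The [K]-th contribution [S2] is isolated from the full sum [S], the tail error [S - (S1 + S2)]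
   and the earlier terms [S1]. *)
have := ler_normD (S - (S1 + S2)) S1; have := ler_normB S (S - (S1 + S2) + S1).
have -> : S - (S - (S1 + S2) + S1) = S2 by ring.
by lra.
Qed.

(** * The lacunary function *)

Section lacunary_series.
Context {R : realType}.
Variables (s : nat) (m : nat -> nat).
Hypotheses (m_gt0 : forall k, (0 < m k)%N) (m_mono : forall k, (m k <= m k.+1)%N).

Definition lacunary_amp (k : nat) : R := 16^-1 ^+ k / (m k)%:R ^+ s.
Definition lacunary_freq (k : nat) : R := 2 * pi * (m k)%:R.
Definition lacunary_cos : circle R -> R :=
  circle_lift (cos_series lacunary_amp lacunary_freq 0).

Local Notation a := lacunary_amp.
Local Notation w := lacunary_freq.

Let mR1 k : 1 <= (m k)%:R :> R. Proof. by rewrite ler1n. Qed.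

Lemma lacunary_freq_ge1 k : 1 <= w k.
Proof.
have := @pi_ge2 R; have := mR1 k; rewrite /lacunary_freq => h1 h2.
by rewrite -[leLHS]mulr1 ler_pM//; lra.
Qed.

Lemma lacunary_amp_gt0 k : 0 < a k.
Proof. by rewrite divr_gt0// exprn_gt0// ?invr_gt0// (lt_le_trans ltr01). Qed.

Lemma lacunary_amp_le1 k : a k <= 1.
Proof.
rewrite ler_pdivrMr ?exprn_gt0 ?(lt_le_trans ltr01)// mul1r.
by rewrite (@le_trans _ _ 1)// ?exprn_ile1 ?exprn_ege1//; lra.
Qed.

Lemma lacunary_amp_shift K k : a (K + k)%N <= a K * 16^-1 ^+ k.
Proof.
have mK : (m K <= m (K + k))%N.
  by elim: k => [|k IH]; rewrite ?addn0// addnS (leq_trans IH).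
rewrite /lacunary_amp exprD -mulrA -[leRHS]mulrA (mulrC _ (16^-1 ^+ k)).
rewrite ler_wpM2l ?exprn_ge0// ler_wpM2l ?exprn_ge0//.
by rewrite lef_pV2 ?posrE ?exprn_gt0 ?(lt_le_trans ltr01)// lerXn2r ?nnegrE ?ler0n// ler_nat.
Qed.

(** Frequencies are at least [1], so [j] may be raised to [s], where the powers of [m k] cancel
    exactly. *)
Lemma lacunary_amp_freq k j : (j <= s)%N ->
  `|a k| * w k ^+ j <= (2 * pi) ^+ s * 16^-1 ^+ k.
Proof.
move=> js; rewrite ger0_norm ?(ltW (lacunary_amp_gt0 k))//.
have w1 := lacunary_freq_ge1 k.
apply: (@le_trans _ _ (a k * w k ^+ s)).
  by rewrite ler_wpM2l ?(ltW (lacunary_amp_gt0 k))// ler_weXn2l.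
have m0 : (m k)%:R != 0 :> R by rewrite gt_eqF// (lt_le_trans ltr01).
rewrite /lacunary_amp /lacunary_freq exprMn le_eqVlt; apply/orP; left; apply/eqP.
by field; rewrite expf_neq0.
Qed.

Lemma cos_series_lacunary_periodic (b : nat -> R) t x :
  cos_series b w t (x + 1) = cos_series b w t x.
Proof.
rewrite /cos_series; set u := fun k => _; set u' := fun k => b k * cos (w k * x + t).
suff -> : u = u' by [].
apply/funext => k; rewrite /u /u'; congr (_ * _).
have -> : w k * (x + 1) + t = w k * x + t + (pi *+ 2) *+ m k.
  by rewrite /lacunary_freq -(mulr_natr (pi *+ 2)) -(mulr_natr pi); ring.
by rewrite (periodicn (@cosD2pi R)).
Qed.

(** Two spare powers of the frequency pay for the quadratic Taylor remainder. *)
Lemma is_derive_lacunary j (t x : R) : (j.+2 <= s)%N ->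
  is_derive x 1 (cos_series (fun k => a k * w k ^+ j) w t)
    (cos_series (fun k => a k * w k ^+ j.+1) w (t + pi / 2) x).
Proof.
move=> js.
have -> : (fun k => a k * w k ^+ j.+1) = (fun k => a k * w k ^+ j * w k).
  by apply/funext => k; rewrite exprSr mulrA.
apply: (@is_derive_cos_series _ _ _ ((2 * pi) ^+ s) lacunary_freq_ge1) => k.
rewrite normrM (ger0_norm (exprn_ge0 _ _)) ?(le_trans ler01 (lacunary_freq_ge1 k))//.
by rewrite -mulrA -exprD addn2 lacunary_amp_freq.
Qed.

Lemma derive1n_lacunary j : (j < s)%N ->
  ((cos_series a w 0)^`(j))%classic = cos_series (fun k => a k * w k ^+ j) w (pi / 2 *+ j).
Proof.
elim: j => [|j IH] js.
  rewrite derive1n0; congr cos_series.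
  by apply/funext => k; rewrite expr0 mulr1.
rewrite derive1nS IH; last exact: ltnW.
apply/funext => x; rewrite derive1E (mulrSr (pi / 2)).
exact: (@derive_val _ _ _ _ _ _ _ (is_derive_lacunary j (pi / 2 *+ j) x js)).
Qed.

Lemma lacunary_cosE x : lacunary_cos (to_circle x) = cos_series a w 0 x.
Proof. by apply: circle_liftE => y; exact: cos_series_lacunary_periodic. Qed.

(** All derivatives up to order [r] are themselves differentiable; for the [r]-th one this yields
    the continuity. *)
Lemma lacunary_cos_Cr r : (r.+2 <= s)%N -> circle_Cr r lacunary_cos.
Proof.
move=> rs; rewrite /circle_Cr.
have -> : lacunary_cos \o to_circle = cos_series a w 0.
  by apply/funext => x; exact: lacunary_cosE.
have D j x : (j <= r)%N -> derivable ((cos_series a w 0)^`(j))%classic x 1.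
  move=> jr; rewrite derive1n_lacunary ?(leq_trans _ rs)// 1?ltnS ?(leq_trans jr)//.
  by apply: (@ex_derive _ _ _ _ _ _ _ (is_derive_lacunary _ _ _ _)); rewrite (leq_trans _ rs).
split=> [k x kr|x]; first exact/D/ltnW.
exact/differentiable_continuous/derivable1_diffP/D.
Qed.

(** The omitted amplitudes start below [a K / 16] and decay geometrically, which costs a factor
    [16 / 15]. *)
Lemma lacunary_cos_approx K z :
  `|lacunary_cos z - \sum_(k < K.+1) a k * circle_cos (m k) z| <= a K / 15.
Proof.
have := @geometric_dominated_tail R
  (fun k => a k * cos (w k * repr z + 0)) (a K / 16) K.+1.
have cv : cvgn (series (fun k => a k * cos (w k * repr z + 0))).
  apply: (@cos_series_cvg _ _ _ ((2 * pi) ^+ s)) => k.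
  by have := lacunary_amp_freq k 0 isT; rewrite expr0 mulr1.
move=> /(_ cv).
rewrite -/(cos_series a w 0 (repr z)) -/(lacunary_cos z) /series /= big_mkord.
rewrite (eq_bigr (fun k : 'I_K.+1 => a k * circle_cos (m k) z)); last first.
  by move=> k _; rewrite addr0.
move=> H; apply: le_trans (H _) _; last by lra.
move=> k; rewrite normrM (ger0_norm (ltW (lacunary_amp_gt0 _))).
rewrite (@le_trans _ _ (a (K.+1 + k)%N))//.
  by rewrite ler_piMr ?cos_max// ltW// lacunary_amp_gt0.
by rewrite addSnnS (le_trans (lacunary_amp_shift _ _))// exprS; lra.
Qed.

Lemma lacunary_cos_max z : `|lacunary_cos z| <= 2.
Proof.
have := lacunary_cos_approx 0 z; rewrite big_ord1 => h.
have h1 : `|a 0 * circle_cos (m 0) z| <= 1.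
  rewrite normrM mulr_ile1// ?circle_cos_max// ger0_norm ?lacunary_amp_le1//.
  by rewrite ltW// lacunary_amp_gt0.
have := ler_normD (lacunary_cos z - a 0 * circle_cos (m 0) z) (a 0 * circle_cos (m 0) z).
by rewrite subrK; have := lacunary_amp_le1 0; lra.
Qed.

Hypothesis s_ge2 : (2 <= s)%N.

Let cF : continuous (cos_series a w 0).
Proof.
move=> x; apply/differentiable_continuous/derivable1_diffP.
have := @ex_derive _ _ _ _ _ _ _ (is_derive_lacunary 0 0 x s_ge2).
by under [X in cos_series X]eq_fun do rewrite expr0 mulr1.
Qed.

Lemma measurable_lacunary_cos : measurable_fun [set: circle R] lacunary_cos.
Proof. by apply: measurable_circle_lift => // y; exact: cos_series_lacunary_periodic. Qed.

(** Dividing the amplitudes by the frequencies and shifting the phase by [- (pi / 2)] gives a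
    1-periodic antiderivative. *)
Lemma mean_lacunary_cos : \int[circle_lebesgue]_z lacunary_cos z = 0.
Proof.
pose G := cos_series (fun k => a k / w k) w (- (pi / 2)).
have dG (x : R) : is_derive x 1 G (cos_series a w 0 x).
  have w0 k : 0 < w k := lt_le_trans ltr01 (lacunary_freq_ge1 k).
  have -> : cos_series a w 0 x =
      cos_series (fun k => a k / w k * w k) w (- (pi / 2) + pi / 2) x.
    rewrite addNr; congr cos_series; apply/funext => k.
    by rewrite divfK// gt_eqF.
  apply: (@is_derive_cos_series _ _ _ ((2 * pi) ^+ s) lacunary_freq_ge1) => k.
  rewrite normrM normfV (ger0_norm (ltW (w0 k))) expr2 mulrA divfK ?gt_eqF//.
  by have := lacunary_amp_freq k 1 (ltnW s_ge2); rewrite expr1.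
have Fb x : `|cos_series a w 0 x| <= 2 by rewrite -lacunary_cosE; exact: lacunary_cos_max.
rewrite (@mean_circle_lift _ _ _ 2 (cos_series_lacunary_periodic _ _) cF Fb dG).
by rewrite -[X in G X]add0r /G cos_series_lacunary_periodic subrr.
Qed.

(** A constant of mean zero is [0], whereas the value at [0] is within [a 0 / 15] of [a 0 > 0]. *)
Lemma lacunary_cos_nonconstant : ~ (exists b : R, forall z, lacunary_cos z = b).
Proof.
move=> [b Hb].
have b0 : b = 0.
  rewrite -mean_lacunary_cos -[LHS](mean_cst circle_lebesgue).
  by apply: eq_Rintegral => z _; rewrite Hb.
have := lacunary_cos_approx 0 (to_circle 0); rewrite Hb b0 big_ord1 circle_cosE.
rewrite mulr0 cos0 mulr1 sub0r normrN ger0_norm ?(ltW (lacunary_amp_gt0 0))//.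
by have := lacunary_amp_gt0 0; lra.
Qed.

End lacunary_series.

(** * Escape of mass at the chosen times *)

Section clt_failure.
Context {R : realType} (alpha : R) (s : nat) (m : nat -> nat).
Hypotheses (m_gt0 : forall k, (0 < m k)%N) (m_mono : forall k, (m k <= m k.+1)%N).
Hypothesis s_ge2 : (2 <= s)%N.

Local Notation a := (@lacunary_amp R s m).
Local Notation c k := (cos (2 * pi * (m k)%:R * alpha)).
Local Notation cost k := (1 + (1 - `|c k|)^-1).

Hypothesis c_lt1 : forall k, `|c k| < 1.

Context {d} {Omega : measurableType d}
  (P : probability Omega R) (Y : nat -> {RV P >-> circle R}).
Hypothesis walkY : markov_process (circle_walk alpha) circle_lebesgue Y.

Local Notation X n w := ((\sum_(k < n) lacunary_cos s m (Y k w)) / Num.sqrt n%:R).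

Lemma measurable_lacunary_sum n : measurable_fun [set: Omega] (fun w => X n w : R).
Proof.
apply: measurable_funM; last exact: measurable_cst.
have bF k : bounded_rv (fun w => lacunary_cos s m (Y k w) : R).
  apply: (bounded_rv_comp (@lacunary_cos R s m) (Y k) 2).
  - exact: measurable_lacunary_cos.
  - exact: lacunary_cos_max.
  - exact: measurable_funPT.
by have [] := bounded_rv_sum n _ bF.
Qed.

(** At time [(L * m K ^ s) ^ 2] the square root times [a K] is [L / 16 ^+ K], which the choice of
    [L] makes large against both [M] and the costs of the earlier terms. A Markov inequality in
    pointwise form then bounds the mass near the origin. *)
Lemma mean_plateau_hump (K M L : nat) :
  (0 < L)%N -> (M + 8 <= K)%N ->
  20 * 16 ^+ K * (K.+1%:R * (1 + \sum_(k < K) cost k)) <= L%:R ->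
  1024 * L%:R ^+ 2 * (m K)%:R ^+ (2 * s) * (1 - c K) <= 1 ->
  \int[P]_w plateau M%:R (X ((L * m K ^ s) ^ 2)%N w) <= 3 / 4.
Proof.
move=> L0 MK HL Hc.
set N := ((L * m K ^ s) ^ 2)%N; pose rt : R := L%:R * (m K)%:R ^+ s.
have mK0 : 0 < (m K)%:R :> R by rewrite ltr0n.
have LR0 : 0 < L%:R :> R by rewrite ltr0n.
have rt0 : 0 < rt by rewrite mulr_gt0// exprn_gt0.
have rtN : rt ^+ 2 = N%:R by rewrite natrX natrM natrX.
have sqrtN : Num.sqrt N%:R = rt by rewrite -rtN sqrtr_sqr gtr0_norm.
have N0 : (0 < N)%N by rewrite expn_gt0 muln_gt0 L0 expn_gt0 m_gt0.
have NR0 : 0 < N%:R :> R by rewrite ltr0n.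
set D := \sum_(k < K) cost k in HL.
have cost_ge0 k : 0 <= cost k by rewrite addr_ge0// invr_ge0 subr_ge0 ltW.
have D0 : 0 <= D by exact: sumr_ge0.
(* The largest [Q] for which a main term of at least [L / 16 ^+ K / 20] still keeps the normalised
   sum beyond [M + 1]. *)
pose T : R := L%:R / 16 ^+ K / 20 - (M%:R + 1).
have HT : 8 * (1 + D) <= T.
  have h1 : K.+1%:R * (1 + D) <= L%:R / 16 ^+ K / 20.
    by rewrite !ler_pdivlMr// ?exprn_gt0//; move: HL; set x := 16 ^+ K; lra.
  (* As [K + 1] is at least [M + 9], subtracting [M + 1] leaves at least [8 * (1 + D)]. *)
  have h2 : (M%:R + 9) * (1 + D) <= K.+1%:R * (1 + D).
    rewrite ler_wpM2r ?addr_ge0// -[K.+1%:R]natr1.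
    have : (M + 8)%:R <= K%:R :> R by rewrite ler_nat.
    by rewrite natrD; lra.
  have h3 : 0 <= M%:R * D by rewrite mulr_ge0.
  by rewrite /T; lra.
have T0 : 0 < T by lra.
pose e k j w : R := circle_cos (m k) (Y j w).
have be k j : bounded_rv (e k j) by exact: bounded_rv_cos.
pose A w := N%:R^-1 * \sum_(j < N) (e K j w - e K 0%N w) ^+ 2.
pose Q w := \sum_(k < K) (1 + (\sum_(j < N) e k j w) ^+ 2 / N%:R) / 2.
(* This majorant is at least [1] in each bad case: initial cosine below [1 / 4] in absolute value,
   [A] above [1 / 64], or [Q] above [T]. Otherwise the main factor is at least [1 / 4 - 1 / 16 - 1 /
   16 - 1 / 15 >= 1 / 20] and the plateau vanishes. *)
pose G w := 17 / 16 - e K 0%N w ^+ 2 + (64 * A w + T^-1 * Q w).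
have A0 w : 0 <= A w by rewrite mulr_ge0 ?invr_ge0// sumr_ge0// => j _; exact: sqr_ge0.
have Q0 w : 0 <= Q w.
  apply: sumr_ge0 => k _; rewrite divr_ge0// addr_ge0// divr_ge0 ?sqr_ge0//.
have e1 w : e K 0%N w ^+ 2 <= 1.
  by rewrite -(real_normK (num_real _)) exprn_ile1// circle_cos_max.
have TQ w : 0 <= T^-1 * Q w by rewrite mulr_ge0// invr_ge0 ltW.
have aK : rt * a K = L%:R / 16 ^+ K.
  by rewrite /lacunary_amp /rt exprVn; field; rewrite !expf_neq0// gt_eqF.
have pointwise w : plateau M%:R (X N w) <= G w.
  have G1 : 1 <= G w -> plateau M%:R (X N w) <= G w by apply: le_trans (plateau_le1 _ _).
  have [ew|ew] := ltP (`|e K 0%N w|) (1 / 4).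
    apply: G1; have : e K 0%N w ^+ 2 <= 1 / 16.
      by rewrite -(real_normK (num_real _)); have := normr_ge0 (e K 0%N w); nra.
    by have := A0 w; have := TQ w; rewrite /G; lra.
  have [Aw|Aw] := ltP (1 / 64) (A w).
    by apply: G1; have := e1 w; have := TQ w; rewrite /G; lra.
  have [Qw|Qw] := ltP T (Q w).
    apply: G1; have : 1 <= T^-1 * Q w by rewrite mulrC ler_pdivlMr// mul1r ltW.
    by have := A0 w; have := e1 w; rewrite /G; lra.
  rewrite plateau_eq0; first by have := A0 w; have := e1 w; have := TQ w; rewrite /G; lra.
  have a01 k : 0 <= a k <= 1 by rewrite ltW ?lacunary_amp_gt0//= lacunary_amp_le1.
  rewrite sqrtN; apply: le_trans (hump_lower_bound N K rt a
    (fun j => lacunary_cos s m (Y j w)) (fun k j => e k j w) N0 rt0 rtN a01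
    (fun j => lacunary_cos_approx s m m_gt0 m_mono K (Y j w))).
  rewrite -/(A w) -/(Q w) aK; set x := L%:R / 16 ^+ K.
  have x0 : 0 < x by rewrite divr_gt0// exprn_gt0.
  have : x * (1 / 20) <= x * (`|e K 0%N w| - 1 / 16 - 4 * A w - 1 / 15).
    by rewrite ler_wpM2l ?(ltW x0)//; lra.
  by move: Qw; rewrite /T -/x; lra.
have bd j : bounded_rv (fun w => (e K j w - e K 0%N w) ^+ 2).
  by apply: bounded_rvX; exact: bounded_rvB.
have bS k : bounded_rv (fun w => (\sum_(j < N) e k j w) ^+ 2).
  by apply: bounded_rvX; exact: (bounded_rv_sum N (e k)).
have bA : bounded_rv A.
  apply: bounded_rvZ.
  exact: (bounded_rv_sum N (fun j w => (e K j w - e K 0%N w) ^+ 2)).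
have bQk k : bounded_rv (fun w => (1 + (\sum_(j < N) e k j w) ^+ 2 / N%:R) / 2).
  apply: bounded_rvM; last exact: bounded_rv_cst.
  apply: bounded_rvD; first exact: bounded_rv_cst.
  by apply: bounded_rvM => //; exact: bounded_rv_cst.
have bQ : bounded_rv Q.
  exact: (bounded_rv_sum K (fun k w =>
    (1 + (\sum_(j < N) e k j w) ^+ 2 / N%:R) / 2)).
have be2 := bounded_rvX _ 2 (be K 0%N).
have b17 : bounded_rv (fun w => 17 / 16 - e K 0%N w ^+ 2 : R).
  by apply: bounded_rvB => //; exact: bounded_rv_cst.
have bAQ : bounded_rv (fun w => 64 * A w + T^-1 * Q w).
  by apply: bounded_rvD; exact: bounded_rvZ.
have bp : bounded_rv (fun w => plateau M%:R (X N w)).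
  split; last by exists 1 => w; rewrite ger0_norm ?plateau_ge0 ?plateau_le1.
  apply: (measurableT_comp (measurable_plateau M%:R)).
  exact: measurable_lacunary_sum.
apply: (le_trans (le_mean P _ _ bp (bounded_rvD _ _ b17 bAQ) pointwise)).
rewrite meanD// meanB//; last exact: bounded_rv_cst.
rewrite mean_cst (mean_cos_sqr alpha P Y walkY)// meanD; [|exact: bounded_rvZ|exact: bounded_rvZ].
rewrite (meanZ P 64 A bA) (meanZ P _ Q bQ).
have EA : \int[P]_w A w <= N%:R * (1 - c K).
  rewrite meanZ; last exact: (bounded_rv_sum N (fun j w => (e K j w - e K 0%N w) ^+ 2)).
  rewrite (mean_sum P N (fun j w => (e K j w - e K 0%N w) ^+ 2))//.
  rewrite ler_pdivrMl//.
  have -> : N%:R * (N%:R * (1 - c K)) = \sum_(j < N) (N%:R * (1 - c K)).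
    by rewrite sumr_const card_ord mulr_natl.
  apply: ler_sum => j _; apply: le_trans (mean_cos_increment_sqr alpha P Y walkY _ _ _) _ => //.
  by rewrite ler_wpM2r ?subr_ge0 ?cos_le1// ler_nat ltnW.
have Nc : N%:R * (1 - c K) <= 1 / 1024.
  have -> : N%:R = L%:R ^+ 2 * (m K)%:R ^+ (2 * s) :> R.
    by rewrite -rtN /rt exprMn -exprM mulnC.
  by move: Hc; lra.
(* The second-moment bound gives each summand a mean of at most [(1 + 1 + 2 / (1 - |c k|)) / 2],
   which is [cost k]. *)
have EQ : \int[P]_w Q w <= D.
  rewrite (mean_sum P K (fun k w => (1 + (\sum_(j < N) e k j w) ^+ 2 / N%:R) / 2))//.
  apply: ler_sum => k _.
  have -> : \int[P]_w ((1 + (\sum_(j < N) e k j w) ^+ 2 / N%:R) / 2) =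
      1 / 2 + (2 * N%:R)^-1 * \int[P]_w (\sum_(j < N) e k j w) ^+ 2.
    rewrite -meanZ// -(mean_cst P (1 / 2)) -meanD; [|exact: bounded_rv_cst|exact: bounded_rvZ].
    by apply: eq_Rintegral => w _; field; rewrite gt_eqF.
  have := mean_cos_sum_sqr alpha P Y walkY (m k) N (m_gt0 k) (c_lt1 k).
  rewrite -/(e k) => h.
  have : (2 * N%:R)^-1 * \int[P]_w (\sum_(j < N) e k j w) ^+ 2 <= (1 + 2 / (1 - `|c k|)) / 2.
    rewrite ler_pdivrMl ?mulr_gt0//; apply: le_trans h _.
    by rewrite le_eqVlt; apply/orP; left; apply/eqP; field; rewrite subr_eq0 gt_eqF.
  by lra.
have TQb : T^-1 * \int[P]_w Q w <= 1 / 8.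
  by rewrite ler_pdivrMl//; lra.
(* The total is [17 / 16 - 1 / 2 + 64 / 1024 + 1 / 8 = 3 / 4]. *)
by lra.
Qed.

End clt_failure.

(** * Choice of the frequencies and conclusion *)

(** The order of choice matters: [L] is fixed from the costs of the earlier frequencies, and only
    then is [m K] taken as a denominator good enough for this [L]. *)
Lemma lacunary_frequencies {R : realType} (alpha c gamma : R) (s : nat) :
  irrational alpha -> 0 < c -> s.+2%:R <= gamma ->
  infinite_set [set pq : int * int | pq.2 != 0 /\
    `|alpha - pq.1%:~R / pq.2%:~R| <= c / (`|pq.2%:~R| `^ gamma)] ->
  exists m : nat -> nat,
  [/\ forall k, (0 < m k)%N, forall k, (m k <= m k.+1)%N &
    forall K, exists L : nat, [/\ (0 < L)%N,
      20 * 16 ^+ K * (K.+1%:R * (1 + \sum_(k < K)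
        (1 + (1 - `|cos (2 * pi * (m k)%:R * alpha)|)^-1))) <= L%:R :> R &
      1024 * L%:R ^+ 2 * (m K)%:R ^+ (2 * s) *
        (1 - cos (2 * pi * (m K)%:R * alpha)) <= 1]].
Proof.
move=> irr c0 sg inf.
have [K D N|m [m_mono Hm]] := gliding_sequence
  (fun m => 1 + (1 - `|cos (2 * pi * m%:R * alpha)|)^-1)
  (fun K D m => (0 < m)%N /\ exists L : nat, [/\ (0 < L)%N,
      20 * 16 ^+ K * (K.+1%:R * (1 + D)) <= L%:R &
      1024 * L%:R ^+ 2 * m%:R ^+ (2 * s) *
        (1 - cos (2 * pi * m%:R * alpha)) <= 1]).
  have [L L0 HL] : exists2 L : nat, (0 < L)%N &
      20 * 16 ^+ K * (K.+1%:R * (1 + D)) <= L%:R.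
    by eexists; last exact/ltW/truncnS_gt.
  have L20 : 0 <= 1024 * L%:R ^+ 2 :> R by rewrite mulr_ge0 ?ler0n ?sqr_ge0.
  have [m [Nm m0 Hm]] := good_frequency alpha c gamma s N _ 1 c0 sg ltr01 L20 inf.
  by exists m; split; [|split => //; exists L; split].
by exists m; split => // K; have [] := Hm K.
Qed.

Theorem theorem2 (R : realType) (alpha : R) (alpha_irrational : irrational alpha)
    (c gamma : R) (c_gt0 : 0 < c) (gamma_gt5 : 5 < gamma)
    (alpha_approx : infinite_set [set pq : int * int | pq.2 != 0 /\
       `|alpha - pq.1%:~R / pq.2%:~R| <= c / (`|pq.2%:~R| `^ gamma)])
    (r : nat) (r_gt0 : (0 < r)%N) (r_lt : r%:R < gamma / 2 - 3 / 2)
    (r_max : forall s : nat, (0 < s)%N -> s%:R < gamma / 2 - 3 / 2 -> (s <= r)%N) :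
  exists phi : circle R -> R,
    [/\ ~ (exists a : R, forall x, phi x = a),
        circle_Cr r phi,
        (\int[circle_lebesgue]_x (phi x)%:E = 0)%E
      & forall (d : measure_display) (Omega : measurableType d)
          (P : probability Omega R) (Y : nat -> {RV P >-> circle R}),
          markov_process (circle_walk alpha) circle_lebesgue Y ->
          ~ clt_holds P Y phi].
Proof.
have s_ge2 : (2 <= r.+2)%N by [].
(* The hypothesis on [r] says [2 * r + 3 < gamma], and [r + 4 <= 2 * r + 3] since [1 <= r]. This
   allows [s = r + 2]. *)
have sg : r.+4%:R <= gamma.
  have : 1 <= r%:R :> R by rewrite ler1n.
  have : r.+4%:R = r%:R + 4 :> R by rewrite -addn4 natrD.
  by lra.
have [m [m_gt0 m_mono Hm]] :=
  lacunary_frequencies alpha c gamma r.+2 alpha_irrational c_gt0 sg alpha_approx.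
exists (lacunary_cos r.+2 m); split.
- exact: lacunary_cos_nonconstant.
- exact: lacunary_cos_Cr.
- rewrite -[LHS]fineK.
    by congr (_%:E); exact: mean_lacunary_cos.
  apply: integrable_fin_num => //; apply: bounded_rv_integrable; split.
    exact: measurable_lacunary_cos.
  by exists 2; exact: lacunary_cos_max.
move=> d Omega P Y walkY [sigma _ clt].
(* The level [3 / 4] is the bound that the plateau means satisfy at the chosen times. *)
have [||M [N MN]] := cvg_in_distribution_tight P _ _ (3 / 4) _ clt.
- by move=> n; exact: measurable_lacunary_sum.
- by lra.
pose K := maxn N (M + 8).
have [L [L0 HL Hc]] := Hm K.
have c_lt1 k : `|cos (2 * pi * (m k)%:R * alpha)| < 1.
  exact: norm_cos_irrational_lt1.
have MK : (M + 8 <= K)%N by exact: leq_maxr.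
have := mean_plateau_hump alpha r.+2 m m_gt0 m_mono s_ge2 c_lt1 P Y walkY K M L L0 MK HL Hc.
apply/negP; rewrite -ltNge; apply: MN.
(* The chosen time is at least [L], hence at least [K] and so at least [N]. *)
have KL : (K <= L)%N.
  rewrite -(@ler_nat R); apply: le_trans HL; set D := \sum_(_ < _) _.
  have D0 : 0 <= D.
    by apply: sumr_ge0 => k _; rewrite addr_ge0// invr_ge0 subr_ge0 ltW.
  have h1 : 1 <= 16 ^+ K :> R by rewrite exprn_ege1//; lra.
  have h2 : K%:R <= K.+1%:R * (1 + D).
    by rewrite -[leLHS]mulr1 ler_pM// ?ler_nat//; lra.
  apply: (le_trans h2); rewrite ler_peMl ?mulr_ge0 ?addr_ge0//.
  by lra.
rewrite (leq_trans (leq_maxl N (M + 8)))// (leq_trans KL)//.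
have mL : (0 < L * m K ^ r.+2)%N by rewrite muln_gt0 L0 expn_gt0 m_gt0.
rewrite (leq_trans (leq_pmulr L (n := m K ^ r.+2) _))// ?expn_gt0 ?m_gt0//.
by rewrite -mulnn leq_pmulr.
Qed.
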